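(* Let $n,l\in\mathbb{N}$, $0\le\rho<1$ and $1<r\le2$. Let $q>0$ be such that for every $a\in\mathbb{M}_lS_{\rho,0}^{-\frac{nl}{r}(1-\rho)}(\mathbb{R}^n)$ there is a constant $C_a>0$ with $$\mathcal{M}^{\sharp}_{\frac rl}\big(T_{[a]}(f_1,\dots,f_l)\big)(x)\le C_a\,\mathbf{M}_q(f_1,\dots,f_l)(x),\qquad x\in\mathbb{R}^n,$$ for all Schwartz functions $f_1,\dots,f_l$ on $\mathbb{R}^n$. Then $r\le q$.
   Context: Fourier transform: $\widehat f(\xi)=\int f(x)e^{-2\pi i\langle x,\xi\rangle}\,dx$. For $m\in\mathbb{R}$ and $0\le\delta\le\rho\le1$, the multilinear Hörmander class $\mathbb{M}_lS^m_{\rho,\delta}(\mathbb{R}^n)$ consists of all smooth functions $a$ on $(\mathbb{R}^n)^{l+1}$ such that for all multi-indices $\alpha,\beta_1,\dots,\beta_l\in\mathbb{N}_0^n$ there is a constant $C_{\alpha,\beta_1,\dots,\beta_l}>0$ with $$|\partial_x^\alpha\partial_{\xi_1}^{\beta_1}\cdots\partial_{\xi_l}^{\beta_l}a(x,\xi_1,\dots,\xi_l)|\le C_{\alpha,\beta_1,\dots,\beta_l}(1+|\xi_1|+\cdots+|\xi_l|)^{m+\delta|\alpha|-\rho(|\beta_1|+\cdots+|\beta_l|)}$$ for all $x,\xi_1,\dots,\xi_l\in\mathbb{R}^n$. The associated multilinear pseudo-differential operator is, for Schwartz functions $f_1,\dots,f_l$ on $\mathbb{R}^n$, $$T_{[a]}(f_1,\dots,f_l)(x)=\int_{(\mathbb{R}^n)^l}a(x,\xi_1,\dots,\xi_l)\Big(\prod_{j=1}^l\widehat{f_j}(\xi_j)\Big)e^{2\pi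 i\langle x,\xi_1+\cdots+\xi_l\rangle}\,d\xi_1\cdots d\xi_l .$$ For $0<t<\infty$, the $L^t$-sharp maximal function is $$\mathcal{M}^\sharp_tg(x)=\sup_{Q\ni x}\inf_{c_Q\in\mathbb{C}}\Big(\frac1{|Q|}\int_Q|g(y)-c_Q|^t\,dy\Big)^{1/t},$$ and $$\mathbf{M}(f_1,\dots,f_l)(x)=\sup_{Q\ni x}\frac1{|Q|^l}\int_{Q^l}\prod_{j=1}^l|f_j(u_j)|\,du_1\cdots du_l,\qquad \mathbf{M}_q(f_1,\dots,f_l)(x)=\big(\mathbf{M}(|f_1|^q,\dots,|f_l|^q)(x)\big)^{1/q},$$ where the suprema are over all cubes $Q\subset\mathbb{R}^n$ (sides parallel to the axes) containing $x$, and $Q^l=Q\times\cdots\times Q$. *)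

(* Defs.v *)
From HB Require Import structures.
From mathcomp Require Import all_boot all_order all_algebra.
From mathcomp Require Import complex.
From mathcomp Require Import all_classical all_reals all_analysis.

Set Implicit Arguments.
Unset Strict Implicit.
Unset Printing Implicit Defensive.

Import Order.TTheory GRing.Theory Num.Theory.
Import numFieldNormedType.Exports.

Local Open Scope classical_set_scope.
Local Open Scope ring_scope.

(** The real line is an arbitrary [R : realType].  Points of R^n are row
    vectors ['rV[R]_n]; a point (xi_1, ..., xi_l) of (R^n)^l is a matrix
    ['M[R]_(l, n)] whose rows are the xi_j, and a point (x, xi_1, ..., xi_l) of
    (R^n)^(l+1) is [col_mx x xi : 'M[R]_(1 + l, n)]. *)

Section lebesgue_tuple.
Context {R : realType}.
Let T : measurableType _ := measurableTypeR R.

Definition cons_pair n (p : T * n.-tuple T) : n.+1.-tuple T :=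
  [tuple of p.1 :: p.2].

Definition uncons_pair n (t : n.+1.-tuple T) : T * n.-tuple T :=
  (thead t, [tuple of behead t]).

Lemma cons_pairK n : cancel (@cons_pair n) (@uncons_pair n).
Proof. by move=> [x t]; congr (_, _); exact: val_inj. Qed.

Lemma uncons_pairK n : cancel (@uncons_pair n) (@cons_pair n).
Proof. by move=> t; rewrite [RHS]tuple_eta. Qed.

Lemma measurable_cons_pair n :
  measurable_fun [set: T * n.-tuple T] (@cons_pair n).
Proof. exact: measurable_cons. Qed.

Lemma measurable_uncons_pair n :
  measurable_fun [set: n.+1.-tuple T] (@uncons_pair n).
Proof.
apply/measurable_fun_pairP; split; first exact: (measurable_tnth ord0).
exact: measurable_behead.
Qed.

Section step.
Context n (mu : {sigma_finite_measure set (n.-tuple T) -> \bar R}).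
Local Open Scope ereal_scope.

Definition lebesgue_tupleS : set (n.+1.-tuple T) -> \bar R :=
  pushforward ((@lebesgue_measure R) \x mu) (@cons_pair n).

Let tupleS0 : lebesgue_tupleS set0 = 0.
Proof. by rewrite /lebesgue_tupleS /pushforward preimage_set0 measure0. Qed.

Let tupleS_ge0 A : 0 <= lebesgue_tupleS A.
Proof. exact: integral_ge0. Qed.

Let tupleS_sigma_additive : semi_sigma_additive lebesgue_tupleS.
Proof.
move=> F mF tF mUF; rewrite /lebesgue_tupleS /pushforward preimage_bigcup.
have mpre A : measurable A -> measurable (@cons_pair n @^-1` A).
  by move=> mA; rewrite -[X in measurable X]setTI; exact: measurable_cons_pair.
apply: measure_semi_sigma_additive.
- by move=> k; exact: mpre.
- apply/trivIsetP => /= i j _ _ ij; rewrite -preimage_setI.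
  by move/trivIsetP : tF => /(_ _ _ _ _ ij) ->//; rewrite preimage_set0.
- by rewrite -preimage_bigcup; exact: mpre.
Qed.

HB.instance Definition _ := isMeasure.Build _ _ _
  lebesgue_tupleS tupleS0 tupleS_ge0 tupleS_sigma_additive.

Let tupleS_sigma_finite : sigma_finite setT lebesgue_tupleS.
Proof.
have /sigma_finiteP[F [TF ndF Foo]] := sigma_finiteT (@lebesgue_measure R).
have /sigma_finiteP[G [TG ndG Goo]] := sigma_finiteT mu.
exists (fun k => @uncons_pair n @^-1` (F k `*` G k)).
  rewrite -preimage_bigcup (_ : \bigcup_k _ = setT) ?preimage_setT//.
  rewrite -setXTT TF TG predeqE => -[x y]; split.
    by move=> [k _ []/= ? ?]; split; exists k.
  move=> [/= [k _ Fx] [k' _ Gy]]; exists (maxn k k') => //; split.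
  - by move: x Fx; exact/subsetPset/ndF/leq_maxl.
  - by move: y Gy; exact/subsetPset/ndG/leq_maxr.
move=> k; have [? ?] := Foo k; have [? ?] := Goo k; split.
  rewrite -[X in measurable X]setTI; apply: measurable_uncons_pair => //.
  exact: measurableX.
rewrite /lebesgue_tupleS /pushforward -comp_preimage.
rewrite (_ : _ \o _ = id) ?preimage_id; last first.
  by rewrite funeqE => p; exact: cons_pairK.
by rewrite product_measure1E// lte_mul_pinfty// ge0_fin_numE.
Qed.

HB.instance Definition _ := Measure_isSigmaFinite.Build _ _ _
  lebesgue_tupleS tupleS_sigma_finite.

End step.

(** n-dimensional Lebesgue measure: the n-fold product of the
    one-dimensional one. *)
Fixpoint lebesgue_tuple n : {sigma_finite_measure set (n.-tuple T) -> \bar R} :=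
  if n is n'.+1 return {sigma_finite_measure set (n.-tuple T) -> \bar R}
  then lebesgue_tupleS (lebesgue_tuple n')
  else \d_([tuple] : 0.-tuple T).

End lebesgue_tuple.

Fact matrix_display : measure_display.
Proof. exact: default_measure_display. Qed.

(** As [R] is second countable, the sigma-algebra generated by the entries is
    the Borel sigma-algebra. *)
Section matrix_measurable.
Context (R : realType) (m n : nat).

Definition matrix_sigma_algebra : set (set 'M[R]_(m, n)) :=
  <<s \bigcup_ij
        preimage_set_system setT
          (fun A : 'M[R]_(m, n) => A ij.1 ij.2 : measurableTypeR R) measurable >>.

Let matrix_set0 : matrix_sigma_algebra set0.
Proof. exact: sigma_algebra0. Qed.

Let matrix_setC A : matrix_sigma_algebra A -> matrix_sigma_algebra (~` A).
Proof. exact: sigma_algebraC. Qed.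

Let matrix_bigcup (F : _^nat) : (forall i, matrix_sigma_algebra (F i)) ->
  matrix_sigma_algebra (\bigcup_i (F i)).
Proof. exact: sigma_algebra_bigcup. Qed.

HB.instance Definition _ := @isMeasurable.Build matrix_display 'M[R]_(m, n)
  matrix_sigma_algebra matrix_set0 matrix_setC matrix_bigcup.

End matrix_measurable.

Section lebesgue_mx.
Context {R : realType} {m n : nat}.
Let T : measurableType _ := measurableTypeR R.

Definition mx_of_tuple (t : (m * n).-tuple T) : 'M[R]_(m, n) :=
  \matrix_(i, j) tnth t (mxvec_index i j).

Lemma measurable_mx_of_tuple :
  measurable_fun [set: (m * n).-tuple T] mx_of_tuple.
Proof.
apply: (@measurability _ _ _ _ _ _
  (\bigcup_ij preimage_set_system setT
    (fun A : 'M[R]_(m, n) => A ij.1 ij.2 : T) measurable)) => //.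
move=> _ [_ [ij _ [B mB <-]] <-]; rewrite !setTI -comp_preimage.
rewrite (_ : _ \o _ = fun t => tnth t (mxvec_index ij.1 ij.2)); last first.
  by apply/funext => t /=; rewrite mxE.
by rewrite -[X in measurable X]setTI; exact: measurable_tnth.
Qed.

Local Open Scope ereal_scope.

(** Lebesgue measure on R^(mn), seen as a space of matrices; the case [m = 1]
    is Lebesgue measure on R^n. *)
Definition lebesgue_mx : set 'M[R]_(m, n) -> \bar R :=
  pushforward (@lebesgue_tuple R (m * n)) mx_of_tuple.

Let lebesgue_mx0 : lebesgue_mx set0 = 0.
Proof. by rewrite /lebesgue_mx /pushforward preimage_set0 measure0. Qed.

Let mpre A : measurable A -> measurable (mx_of_tuple @^-1` A).
Proof.
by move=> mA; rewrite -[X in measurable X]setTI; exact: measurable_mx_of_tuple.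
Qed.

Let lebesgue_mx_ge0 A : 0 <= lebesgue_mx A.
Proof. exact: (measure_ge0 (lebesgue_tuple _)). Qed.

Let lebesgue_mx_sigma_additive : semi_sigma_additive lebesgue_mx.
Proof.
move=> F mF tF mUF; rewrite /lebesgue_mx /pushforward preimage_bigcup.
apply: measure_semi_sigma_additive.
- by move=> k; exact: mpre.
- apply/trivIsetP => /= i j _ _ ij; rewrite -preimage_setI.
  by move/trivIsetP : tF => /(_ _ _ _ _ ij) ->//; rewrite preimage_set0.
- by rewrite -preimage_bigcup; exact: mpre.
Qed.

HB.instance Definition _ := isMeasure.Build _ _ _
  lebesgue_mx lebesgue_mx0 lebesgue_mx_ge0 lebesgue_mx_sigma_additive.

End lebesgue_mx.

Local Open Scope complex_scope.

Section definitions.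
Context {R : realType}.
Local Notation C := R[i].
Local Notation Re := (@complex.Re R).
Local Notation Im := (@complex.Im R).

Definition cabs (z : C) : R := ComplexField.Normc.normc z.

Definition cis (t : R) : C := cos t +i* sin t.

Definition dotp n (x y : 'rV[R]_n) : R := \sum_(i < n) x 0 i * y 0 i.

(** The library norm on ['rV[R]_n] is the sup norm. *)
Definition enorm n (x : 'rV[R]_n) : R := Num.sqrt (dotp x x).

Definition cintegral m n (f : 'M[R]_(m, n) -> C) : C :=
  (\int[lebesgue_mx]_x Re (f x)) +i* (\int[lebesgue_mx]_x Im (f x)).

Section derivatives.
Context {m n : nat}.
Implicit Types f : 'M[R]_(m, n) -> C.

Definition cpartial (ij : 'I_m * 'I_n) f : 'M[R]_(m, n) -> C := fun x =>
  ('D_(delta_mx ij.1 ij.2) (Re \o f) x) +i*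
  ('D_(delta_mx ij.1 ij.2) (Im \o f) x).

(** C^oo: all iterated partial derivatives exist and are Frechet
    differentiable, hence continuous. *)
Definition smooth f := forall (s : seq ('I_m * 'I_n)) (x : 'M[R]_(m, n)),
  differentiable (Re \o foldr cpartial f s) x /\
  differentiable (Im \o foldr cpartial f s) x.

(** Partial derivative of multi-index [al]; it is only used for smooth
    functions, for which the order of differentiation is irrelevant. *)
Definition multi_partial (al : 'M[nat]_(m, n)) f : 'M[R]_(m, n) -> C :=
  foldr (fun ij g => iter (al ij.1 ij.2) (cpartial ij) g) f
        (enum {: 'I_m * 'I_n}).

Definition mi_length (al : 'M[nat]_(m, n)) : nat :=
  (\sum_(i < m) \sum_(j < n) al i j)%N.

End derivatives.

Definition schwartz n (f : 'rV[R]_n -> C) :=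
  smooth f /\
  forall al be : 'rV[nat]_n, exists K : R, forall x : 'rV[R]_n,
    `|\prod_(i < n) x 0 i ^+ al 0 i| * cabs (multi_partial be f x) <= K.

Definition fourier n (f : 'rV[R]_n -> C) : 'rV[R]_n -> C := fun xi =>
  cintegral (fun x => f x * cis (- (2 * pi * dotp x xi))).

(** The class M_l S^m_{rho,delta}(R^n); row [j] of [be] is the multi-index
    beta_j. *)
Definition symbol_class l n (m rho delta : R) (a : 'M[R]_(1 + l, n) -> C) :=
  smooth a /\
  forall (al : 'rV[nat]_n) (be : 'M[nat]_(l, n)), exists2 K : R, 0 < K &
    forall (x : 'rV[R]_n) (xi : 'M[R]_(l, n)),
      cabs (multi_partial (col_mx al be) a (col_mx x xi)) <=
      K * (1 + \sum_(j < l) enorm (row j xi)) `^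
            (m + delta * (mi_length al)%:R - rho * (mi_length be)%:R).

Definition psido l n (a : 'M[R]_(1 + l, n) -> C)
    (f : 'I_l -> 'rV[R]_n -> C) : 'rV[R]_n -> C := fun x =>
  cintegral (fun xi : 'M[R]_(l, n) =>
    a (col_mx x xi) * (\prod_(j < l) fourier (f j) (row j xi)) *
    cis (2 * pi * dotp x (\sum_(j < l) row j xi))).

(** Closed cubes with positive side length.  Open cubes yield the same
    suprema below. *)
Definition cube n (Q : set 'rV[R]_n) := exists (c : 'rV[R]_n) (s : R),
  0 < s /\ Q = [set y : 'rV[R]_n | forall i, c 0 i <= y 0 i <= c 0 i + s].

Definition cubes_at n (x : 'rV[R]_n) : set (set 'rV[R]_n) :=
  [set Q | cube Q /\ Q x].

Definition vol n (Q : set 'rV[R]_n) : R := fine (lebesgue_mx Q).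

Definition set_power l n (Q : set 'rV[R]_n) : set 'M[R]_(l, n) :=
  [set u : 'M[R]_(l, n) | forall j, Q (row j u)].

Local Open Scope ereal_scope.

Definition sharp_maximal n (t : R) (g : 'rV[R]_n -> C)
    (x : 'rV[R]_n) : \bar R :=
  ereal_sup [set
    ereal_inf [set
      ((vol Q)^-1%:E * \int[lebesgue_mx]_(y in Q) (cabs (g y - c)%R `^ t)%:E)
        `^ t^-1
      | c in [set: C]]
    | Q in cubes_at x].

Definition multi_maximal l n (f : 'I_l -> 'rV[R]_n -> C)
    (x : 'rV[R]_n) : \bar R :=
  ereal_sup [set
    ((vol Q ^+ l)^-1)%:E *
    \int[lebesgue_mx]_(u in @set_power l n Q)
      (\prod_(j < l) cabs (f j (row j u)))%R%:E
    | Q in cubes_at x].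

Definition multi_maximal_q l n (q : R) (f : 'I_l -> 'rV[R]_n -> C)
    (x : 'rV[R]_n) : \bar R :=
  multi_maximal (fun j y => (cabs (f j y) `^ q)%:C) x `^ q^-1.

End definitions.

(* Main.v *)
Require Import Defs.
From mathcomp Require Import all_boot all_order all_algebra.
From mathcomp Require Import complex ring lra.
From mathcomp Require Import all_classical all_reals all_analysis.
From mathcomp Require Import measurable_realfun.

Set Implicit Arguments.
Unset Strict Implicit.
Unset Printing Implicit Defensive.

Import Order.TTheory GRing.Theory Num.Theory.
Import numFieldNormedType.Exports.
Local Open Scope classical_set_scope.
Local Open Scope ring_scope.
Local Open Scope complex_scope.

(** The estimate is tested on one symbol that acts at all frequency scales.  With
    N = N(x) = sqrt (1 + x_1^2) and mu = - (n l / r) (1 - rho), put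
      a(x, xi) = N^mu exp (- pi |xi|^2 / N^2)
                      exp (- 2 pi i N^(- rho) sum_j xi_(j,1)).
    Near a point with N(x) = lam this is lam^mu times a cutoff to frequencies of
    size at most lam, followed by a translation by lam^(- rho) along the first
    axis; the dependence on x replaces a dyadic decomposition in xi.

    The symbol has order mu (sym_symbol_class).  Derivatives of a are
    polynomials in x_1, xi and powers of N, times the same exponential factor.
    The Gaussian allows one to count |xi| as N.  A derivative in xi then gains
    at least N^(- rho); a derivative in x loses nothing, because the phase
    N^(- rho) xi_1 varies in x at the rate N^(- rho - 1) |xi|.  As all orders
    are nonpositive, a power of N may be traded for the same power of
    1 + |xi_1| + ... + |xi_l|.

    Fix lam >= 1 and a point x0 with N(x0) = lam.  Let every f_j be the Gaussian
    exp (- pi lam^2 |y - c|^2) with c = x0 - lam^(- rho) e_1.  Fourier transforms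
    of Gaussians and Fubini's theorem turn T_[a](f_1, ..., f_l) into an explicit
    positive wave packet (psido_gaussian).  It has height about lam^mu and width
    about 1 / lam, and the translation has brought it to x0.  So it oscillates by
    a multiple of lam^mu on a cube of side comparable to 1 / lam at x0
    (packet_ge, packet_le, sharp_maximal_ge).  On the other hand the f_j live at
    distance lam^(- rho) from x0, which makes M_q(f_1, ..., f_l)(x0) at most a
    multiple of lam^(- (1 - rho) n l / q) (multi_maximal_gaussian_le).  Hence
      lam^(- (1 - rho) n l / r) <= C lam^(- (1 - rho) n l / q)
    for all lam >= 1, and this forces r <= q. *)

(** * Partial derivatives *)

Section gradients.
Context {R : realType} {m n : nat}.
Local Notation M := 'M[R]_(m, n).
Local Notation dir := ('I_m * 'I_n)%type.

Definition has_grad (F : M -> R) (F' : dir -> M -> R) := forall x : M, differentiable F x /\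
  forall ij, 'D_(delta_mx ij.1 ij.2) F x = F' ij x.

Lemma eq_has_grad (F G : M -> R) F' G' : has_grad F F' -> F =1 G ->
  (forall ij, F' ij =1 G' ij) -> has_grad G G'.
Proof.
move=> dF /funext <- F'G' x; have [dFx FE] := dF x.
by split=> // ij; rewrite FE F'G'.
Qed.

Lemma has_grad_cst (c : R) : has_grad (fun=> c) (fun _ _ => 0).
Proof.
move=> x; split; first exact: differentiable_cst.
by move=> ij; exact: derive_cst.
Qed.

Lemma has_grad_coord i j :
  has_grad (fun x : M => x i j) (fun ij _ => ((ij.1 == i) && (ij.2 == j))%:R).
Proof.
move=> x; split; first exact: differentiable_coord.
move=> [i' j'] /=; rewrite /derive.
rewrite (_ : (fun h => _) = fun h : R => h^-1 *: (h * (delta_mx i' j' : M) i j)).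
  rewrite mxE [i == _]eq_sym [j == _]eq_sym.
  apply/cvg_lim => //; apply: cvg_near_cst.
  near=> h.
  have h0 : h != 0 by near: h; exact: nbhs_dnbhs_neq.
  by rewrite /GRing.scale /= mulrA mulVf// mul1r.
by apply/funext => h; rewrite /= !mxE addrK.
Unshelve. all: by end_near. Qed.

Lemma has_gradD (F G : M -> R) F' G' : has_grad F F' -> has_grad G G' ->
  has_grad (fun x => F x + G x) (fun ij x => F' ij x + G' ij x).
Proof.
move=> dF dG x; have [dFx FE] := dF x; have [dGx GE] := dG x.
split; first exact: differentiableD.
by move=> ij; rewrite deriveD ?FE ?GE//; exact: diff_derivable.
Qed.

Lemma has_gradM (F G : M -> R) F' G' : has_grad F F' -> has_grad G G' ->
  has_grad (fun x => F x * G x) (fun ij x => F' ij x * G x + F x * G' ij x).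
Proof.
move=> dF dG x; have [dFx FE] := dF x; have [dGx GE] := dG x.
split; first exact: differentiableM.
move=> ij; rewrite deriveM ?FE ?GE//; try exact: diff_derivable.
by rewrite addrC /GRing.scale /=; congr (_ + _); rewrite mulrC.
Qed.

Lemma has_grad_comp (h h' : R -> R) (F : M -> R) F' : has_grad F F' ->
  (forall x, is_derive (F x) 1 h (h' (F x))) ->
  has_grad (h \o F) (fun ij x => F' ij x * h' (F x)).
Proof.
move=> dF dh x; have [dFx FE] := dF x.
have dhx : differentiable h (F x) by apply/derivable1_diffP; case: (dh x).
split; first exact: differentiable_comp.
move=> ij; rewrite deriveE; last exact: differentiable_comp.
rewrite diff_comp// /= deriv1E; last exact/derivable1_diffP.
by rewrite derive1E -deriveE// FE; have -> := @derive_val _ _ _ _ _ _ _ (dh x).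
Qed.

End gradients.

(** * Complex numbers *)

Section complex_parts.
Context {R : realType}.
Local Notation C := R[i].
Local Notation Re := (@complex.Re R).
Local Notation Im := (@complex.Im R).

Lemma Re_mulc (x y : C) : Re (x * y) = Re x * Re y - Im x * Im y.
Proof. by case: x => a b; case: y. Qed.

Lemma Im_mulc (x y : C) : Im (x * y) = Re x * Im y + Im x * Re y.
Proof. by case: x => a b; case: y. Qed.

Lemma cabsE (x y : R) : cabs (x +i* y) = Num.sqrt (x ^+ 2 + y ^+ 2).
Proof. by []. Qed.

Lemma cabsM (x y : C) : cabs (x * y) = cabs x * cabs y.
Proof. exact: ComplexField.Normc.normcM. Qed.

Lemma cabs_real (x : R) : cabs x%:C = `|x|.
Proof. by rewrite cabsE expr0n addr0 sqrtr_sqr. Qed.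

Lemma cabs_cis (t : R) : cabs (cis t) = 1.
Proof. by rewrite cabsE cos2Dsin2 sqrtr1. Qed.

Lemma cabs_ge0 (z : C) : 0 <= cabs z.
Proof. by case: z => x y; exact: sqrtr_ge0. Qed.

Lemma cabs_le (x y : R) : cabs (x +i* y) <= `|x| + `|y|.
Proof.
rewrite cabsE -(ger0_norm (_ : 0 <= `|x| + `|y|)) ?addr_ge0//.
rewrite -sqrtr_sqr ler_sqrt ?sqr_ge0// sqrrD !real_normK ?num_real// lerD2r.
by rewrite lerDl mulrn_wge0// mulr_ge0.
Qed.

Lemma normr_Re_le_cabs (z : C) : `|Re z| <= cabs z.
Proof.
by case: z => x y; rewrite cabsE /= -sqrtr_sqr ler_wsqrtr// lerDl sqr_ge0.
Qed.

Lemma cisD (s t : R) : cis (s + t) = cis s * cis t.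
Proof.
by apply/eqP; rewrite eq_complex Re_mulc Im_mulc /= cosD sinD eqxx addrC/= mulrC.
Qed.

Lemma cis0 : cis (0 : R) = 1.
Proof. by apply/eqP; rewrite eq_complex /= cos0 sin0 !eqxx. Qed.

Lemma cis_sum (I : Type) (r : seq I) (t : I -> R) :
  cis (\sum_(i <- r) t i) = \prod_(i <- r) cis (t i).
Proof. exact: (big_morph _ cisD cis0). Qed.

End complex_parts.

(** * Oscillating Gaussians with graded amplitudes *)

Section symbolic_calculus.
Context {R : realType} {m n : nat}.
Local Notation C := R[i].
Local Notation Re := (@complex.Re R).
Local Notation Im := (@complex.Im R).
Local Notation M := 'M[R]_(m, n).
Local Notation dir := ('I_m * 'I_n)%type.

(** The functions of order at most [d] in the algebra generated by [gen].  An
    order bounds the growth of a function, see [graded_bound], and products add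
    orders.  The zero function has every order, so that a vanishing derivative
    never obstructs an estimate. *)
Inductive graded (gen : R -> (M -> R) -> Prop) : R -> (M -> R) -> Prop :=
| graded_gen d F : gen d F -> graded gen d F
| graded0 d : graded gen d (fun=> 0)
| graded_cst c : graded gen 0 (fun=> c)
| gradedD d F G : graded gen d F -> graded gen d G ->
    graded gen d (fun x => F x + G x)
| gradedM d e F G : graded gen d F -> graded gen e G ->
    graded gen (d + e) (fun x => F x * G x)
| graded_le d e F : graded gen d F -> d <= e -> graded gen e F.

(* [shift ij] is the drop of the order under the partial derivative along ij. *)
Context (gen : R -> (M -> R) -> Prop) (shift : dir -> R).
Hypothesis gen_grad : forall d F, gen d F ->
  exists2 F' : dir -> M -> R, has_grad F F' &
    forall ij, graded gen (d - shift ij) (F' ij).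

Lemma graded_sum (I : Type) (r : seq I) d (F : I -> M -> R) :
  (forall i, graded gen d (F i)) ->
  graded gen d (fun x => \sum_(i <- r) F i x).
Proof.
move=> dF; elim: r => [|i r IH].
  by under eq_fun do rewrite big_nil; exact: graded0.
by under eq_fun do rewrite big_cons; exact: gradedD.
Qed.

Lemma gradedN d F : graded gen d F -> graded gen d (fun x => - F x).
Proof.
move=> dF; under eq_fun do rewrite -mulN1r.
by rewrite -[d]add0r; apply: gradedM => //; exact: graded_cst.
Qed.

Lemma graded_grad d F : graded gen d F ->
  exists2 F' : dir -> M -> R, has_grad F F' &
    forall ij, graded gen (d - shift ij) (F' ij).
Proof.
elim=> {d F} [d F /gen_grad//|d|c|d F G _ [F' dF gF] _ [G' dG gG]|
  d e F G gF [F' dF gF'] gG [G' dG gG']|d e F gF [F' dF gF'] de].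
- by exists (fun _ _ => 0); [exact: has_grad_cst|move=> ij; exact: graded0].
- by exists (fun _ _ => 0); [exact: has_grad_cst|move=> ij; exact: graded0].
- exists (fun ij x => F' ij x + G' ij x); first exact: has_gradD.
  by move=> ij; exact: gradedD.
- exists (fun ij x => F' ij x * G x + F x * G' ij x); first exact: has_gradM.
  by move=> ij; apply: gradedD; [rewrite addrAC|rewrite -addrA]; exact: gradedM.
- exists F' => // ij; apply: graded_le (gF' ij) _.
  by rewrite lerD2r.
Qed.

Section oscillating_gaussian.
Context (g phi : M -> R) (g' phi' : dir -> M -> R).
Hypotheses (dg : has_grad g g') (dphi : has_grad phi phi').
Hypotheses (gg : forall ij, graded gen (- shift ij) (g' ij))
           (gphi : forall ij, graded gen (- shift ij) (phi' ij)).

(** The amplitude c1 + i c2 is kept as a pair of real functions because partial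
    derivatives are taken on real and imaginary parts separately. *)
Definition osc (c1 c2 : M -> R) (x : M) : C :=
  (c1 x +i* c2 x) * (expR (g x))%:C * cis (phi x).

Definition osc_class d (f : M -> C) :=
  exists c1 c2, [/\ graded gen d c1, graded gen d c2 & f = osc c1 c2].

Let dexp : has_grad (expR \o g) (fun ij x => g' ij x * expR (g x)).
Proof. by apply: (@has_grad_comp _ _ _ _ expR) => // x; exact: is_derive_expR. Qed.

Let dcos : has_grad (cos \o phi) (fun ij x => phi' ij x * - sin (phi x)).
Proof.
by apply: (@has_grad_comp _ _ _ _ (fun t => - sin t)) => // x; exact: is_derive_cos.
Qed.

Let dsin : has_grad (sin \o phi) (fun ij x => phi' ij x * cos (phi x)).
Proof. by apply: (@has_grad_comp _ _ _ _ cos) => // x; exact: is_derive_sin. Qed.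

Lemma osc_grad c1 c2 c1' c2' : has_grad c1 c1' -> has_grad c2 c2' ->
  let f' ij := osc (fun x => c1' ij x + c1 x * g' ij x - c2 x * phi' ij x)
                   (fun x => c2' ij x + c2 x * g' ij x + c1 x * phi' ij x) in
  has_grad (Re \o osc c1 c2) (fun ij x => Re (f' ij x)) /\
  has_grad (Im \o osc c1 c2) (fun ij x => Im (f' ij x)).
Proof.
move=> dc1 dc2 f'; split.
- apply: (eq_has_grad (has_gradM dexp (has_gradD (has_gradM dc1 dcos)
    (has_gradM (has_gradM (has_grad_cst (-1)) dc2) dsin)))).
    by move=> x /=; ring.
  by move=> ij x /=; ring.
- apply: (eq_has_grad (has_gradM dexp (has_gradD (has_gradM dc1 dsin)
    (has_gradM dc2 dcos)))).
    by move=> x /=; ring.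
  by move=> ij x /=; ring.
Qed.

(** A partial derivative replaces the amplitude c by c' + c (g' + i phi'), and
    the hypotheses on g' and phi' give both terms the order [d - shift ij].  By
    iteration all derivatives of f are oscillating Gaussians of known order. *)
Lemma osc_class_partial d f : osc_class d f ->
  (forall x, differentiable (Re \o f) x /\ differentiable (Im \o f) x) /\
  (forall ij, osc_class (d - shift ij) (cpartial ij f)).
Proof.
move=> [c1 [c2 [gc1 gc2 ->]]].
have [c1' dc1 gc1'] := graded_grad gc1; have [c2' dc2 gc2'] := graded_grad gc2.
have [dRe dIm] := osc_grad dc1 dc2.
split=> [x|ij]; first by split; [exact: (dRe x).1|exact: (dIm x).1].
exists (fun x => c1' ij x + c1 x * g' ij x - c2 x * phi' ij x).
exists (fun x => c2' ij x + c2 x * g' ij x + c1 x * phi' ij x); split.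
- by apply: gradedD; [apply: gradedD => //|apply: gradedN]; exact: gradedM.
- by apply: gradedD; [apply: gradedD => //|]; exact: gradedM.
- apply/funext => x; rewrite /cpartial (dRe x).2 (dIm x).2.
  by rewrite [RHS]complexE [LHS]complexE.
Qed.

Lemma osc_class_smooth d f : osc_class d f -> smooth f.
Proof.
move=> df s; suff [e /osc_class_partial[]//] :
  exists e, osc_class e (foldr cpartial f s).
elim: s => [|ij s [e /osc_class_partial[_ IH]]]; first by exists d.
by exists (e - shift ij); exact: IH.
Qed.

Lemma osc_class_multi_partial d f (al : 'M[nat]_(m, n)) : osc_class d f ->
  osc_class (d - \sum_(ij : dir) (al ij.1 ij.2)%:R * shift ij)
            (multi_partial al f).
Proof.
move=> df; rewrite /multi_partial -big_enum /=.
elim: (enum _) => [|ij s IH] /=; first by rewrite big_nil subr0.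
rewrite big_cons; set S := \sum_(_ <- _) _ in IH *.
elim: (al _ _) => [|k /osc_class_partial[_ /(_ ij) IHk]] /=.
  by rewrite mul0r add0r.
rewrite (_ : _ - _ = d - (k%:R * shift ij + S) - shift ij)//.
by rewrite -natr1; ring.
Qed.

End oscillating_gaussian.
End symbolic_calculus.

(** * Growth of oscillating Gaussians *)

(** Each term is at most the square root of the sum of all squares. *)
Lemma sqr_sum_le {R : realType} (I : finType) (a : I -> R) : (forall i, 0 <= a i) ->
  (\sum_i a i) ^+ 2 <= #|I|%:R ^+ 2 * \sum_i a i ^+ 2.
Proof.
move=> a0; have s0 : 0 <= \sum_i a i ^+ 2 by rewrite sumr_ge0// => i _; exact: sqr_ge0.
have p0 : 0 <= #|I|%:R * Num.sqrt (\sum_i a i ^+ 2) by rewrite mulr_ge0// sqrtr_ge0.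
have q0 : 0 <= \sum_i a i by exact: sumr_ge0.
rewrite -[X in _ * X]sqr_sqrtr// -exprMn ler_pXn2r//.
rewrite mulr_natl -sumr_const ler_sum// => i _.
rewrite -[leLHS]ger0_norm// -sqrtr_sqr ler_sqrt//.
by rewrite (bigD1 i)//= lerDl sumr_ge0// => j _; exact: sqr_ge0.
Qed.

Section growth.
Context {R : realType} {m n : nat}.
Local Notation M := 'M[R]_(m, n).

(** The constant comes from (1 + t)^k <= k! exp (1 + t) and
    t <= c t^2 + 1 / (4 c). *)
Lemma polynomial_gaussian_bounded (k : nat) (c : R) : 0 < c ->
  exists2 K, 0 <= K &
    forall t, 0 <= t -> (1 + t) ^+ k * expR (- (c * t ^+ 2)) <= K.
Proof.
move=> c0; exists (k`!%:R * expR (1 + (4 * c)^-1)) => [|t t0].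
  by rewrite mulr_ge0// expR_ge0.
have -> : 1 + (4 * c)^-1 = (1 + t) + ((4 * c)^-1 - t).
  by ring.
apply: (@le_trans _ _ (k`!%:R * expR (1 + t) * expR (- (c * t ^+ 2)))).
  rewrite ler_pM2r ?expR_gt0//.
  have t1 : 0 <= 1 + t by rewrite addr_ge0.
  case: k => [|k]; first by rewrite fact0 mul1r (le_trans _ (expR_ge1Dx _))// lerDl.
  rewrite mulrC -ler_pdivrMr ?ltr0n ?fact_gt0//.
  by rewrite (le_trans _ (expR_ge1Dxn k t1))// lerDr.
rewrite -mulrA -expRD ler_wpM2l// ler_expR lerD2l.
have : 0 <= c * (t - (2 * c)^-1) ^+ 2 by rewrite mulr_ge0 ?sqr_ge0 ?ltW.
rewrite (_ : c * _ = c * t ^+ 2 - t + (4 * c)^-1) ?subr_ge0; first by lra.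
by field; rewrite gt_eqF.
Qed.

(* [N] carries the order, while powers of [S / N] are left to a Gaussian. *)
Context (gen : R -> (M -> R) -> Prop) (N S : M -> R).
Hypotheses (N_ge1 : forall x, 1 <= N x) (S_ge0 : forall x, 0 <= S x).
Hypothesis gen_bound : forall d F, gen d F -> exists2 K, 0 <= K & exists k : nat,
  forall x, `|F x| <= K * N x `^ d * (1 + S x / N x) ^+ k.

Let N_gt0 x : 0 < N x. Proof. exact: lt_le_trans (N_ge1 x). Qed.

Let base_ge1 x : 1 <= 1 + S x / N x.
Proof. by rewrite lerDl divr_ge0// ltW. Qed.

Lemma graded_bound d F : graded gen d F -> exists2 K, 0 <= K & exists k : nat,
  forall x, `|F x| <= K * N x `^ d * (1 + S x / N x) ^+ k.
Proof.
elim=> {d F} [d F /gen_bound//|d|c|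
  d F G _ [K K0 [k FK]] _ [L L0 [l GL]]|
  d e F G _ [K K0 [k FK]] _ [L L0 [l GL]]|d e F _ [K K0 [k FK]] de].
- by exists 0 => //; exists 0%N => x; rewrite normr0 !mul0r.
- by exists `|c| => //; exists 0%N => x; rewrite powRr0 !mulr1.
- exists (K + L); rewrite ?addr_ge0//; exists (k + l)%N => x.
  rewrite (le_trans (ler_normD _ _))// !mulrDl lerD//.
    rewrite (le_trans (FK x))// ler_wpM2l ?mulr_ge0 ?powR_ge0//.
    by rewrite ler_weXn2l// leq_addr.
  rewrite (le_trans (GL x))// ler_wpM2l ?mulr_ge0 ?powR_ge0//.
  by rewrite ler_weXn2l// leq_addl.
- exists (K * L); rewrite ?mulr_ge0//; exists (k + l)%N => x.
  rewrite normrM powRD; last by rewrite (gt_eqF (N_gt0 x)) implybT.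
  rewrite exprD [leRHS](_ : _ = (K * N x `^ d * (1 + S x / N x) ^+ k) *
    (L * N x `^ e * (1 + S x / N x) ^+ l)); last by ring.
  exact: ler_pM.
- exists K => //; exists k => x; rewrite (le_trans (FK x))//.
  rewrite ler_wpM2r ?exprn_ge0 ?(le_trans _ (base_ge1 x))//.
  by rewrite ler_wpM2l// ler_powR.
Qed.

(** The Gaussian absorbs the powers of 1 + S / N from the amplitude, and any
    further power [j]. *)
Lemma osc_class_bound g phi c d f : 0 < c ->
    (forall x, g x <= - (c * (S x / N x) ^+ 2)) ->
    osc_class gen g phi d f ->
  forall j : nat, exists2 K, 0 < K &
    forall x, (1 + S x / N x) ^+ j * cabs (f x) <= K * N x `^ d.
Proof.
move=> c0 gc [c1 [c2 [/graded_bound[K K0 [k c1K]] /graded_bound[L L0 [l c2L]] ->]]] j.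
have [B B0 BP] := polynomial_gaussian_bounded (j + (k + l)) c0.
exists ((K + L) * B + 1) => [|x]; first by rewrite ltr_pwDr// mulr_ge0 ?addr_ge0.
rewrite /osc !cabsM cabs_cis mulr1 cabs_real ger0_norm ?expR_ge0//.
set s := 1 + S x / N x.
have s1 : 1 <= s := base_ge1 x.
have s0 : 0 <= s by exact: le_trans s1.
have Nd0 : 0 <= N x `^ d by exact: powR_ge0.
have cK : cabs (c1 x +i* c2 x) <= (K + L) * N x `^ d * s ^+ (k + l).
  rewrite (le_trans (cabs_le _ _))// !mulrDl lerD//.
    rewrite (le_trans (c1K x))// ler_wpM2l ?mulr_ge0//.
    by rewrite ler_weXn2l// leq_addr.
  rewrite (le_trans (c2L x))// ler_wpM2l ?mulr_ge0//.
  by rewrite ler_weXn2l// leq_addl.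
apply: (@le_trans _ _ (s ^+ j * ((K + L) * N x `^ d * s ^+ (k + l) *
    expR (- (c * (S x / N x) ^+ 2))))).
  rewrite ler_wpM2l ?exprn_ge0// ler_pM ?expR_ge0 ?ler_expR//.
  exact: sqrtr_ge0.
have := BP (S x / N x); rewrite divr_ge0 ?(ltW (N_gt0 x))// => /(_ isT) BPx.
rewrite [leLHS](_ : _ = (K + L) * N x `^ d * (s ^+ (j + (k + l)) *
    expR (- (c * (S x / N x) ^+ 2)))); last by rewrite !exprD; ring.
apply: (@le_trans _ _ ((K + L) * N x `^ d * B)).
  by rewrite ler_wpM2l// mulr_ge0 ?addr_ge0.
by rewrite mulrAC ler_wpM2r// lerDl.
Qed.

End growth.

(** * The symbol *)

Section symbol.
Context {R : realType} {n l : nat}.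
Local Notation C := R[i].
Local Notation M := 'M[R]_(1 + l, n).
Local Notation dir := ('I_(1 + l) * 'I_n)%type.
Context (i0 : 'I_n).

(** The square of N(x); x is the row of X before the frequencies. *)
Definition xbracket2 (X : M) : R := 1 + X (lshift l 0) i0 ^+ 2.

Definition sym_gauss (X : M) : R :=
  - pi * (\sum_(j < l) \sum_(i < n) X (rshift 1 j) i ^+ 2) * xbracket2 X `^ (- 1).

Definition sym_phase (rho : R) (X : M) : R :=
  - (2 * pi) * (\sum_(j < l) X (rshift 1 j) i0) * xbracket2 X `^ (- (rho / 2)).

Definition sym (mu rho : R) : M -> C :=
  osc sym_gauss (sym_phase rho) (fun X => xbracket2 X `^ (mu / 2)) (fun=> 0).

Inductive sym_gen : R -> (M -> R) -> Prop :=
| sym_gen_x : sym_gen 1 (fun X => X (lshift l 0) i0)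
| sym_gen_xi j i : sym_gen 1 (fun X => X (rshift 1 j) i)
| sym_gen_bracket s : sym_gen (2 * s) (fun X => xbracket2 X `^ s).

Lemma xbracket2_ge1 X : 1 <= xbracket2 X.
Proof. by rewrite lerDl sqr_ge0. Qed.

Let br_gt0 X : 0 < xbracket2 X.
Proof. exact: lt_le_trans (xbracket2_ge1 X). Qed.

(** The order drops by one in every direction, also in x, where [sym_shift] is 0.
    The full drop is what bounds the gradient of the phase: its order is
    1 - rho, so its gradient has order - rho, both in x and in xi. *)
Lemma sym_gen_grad d F : sym_gen d F ->
  exists2 F' : dir -> M -> R, has_grad F F' &
    forall ij, graded sym_gen (d - 1) (F' ij).
Proof.
case=> [|j i|s].
- eexists; first exact: has_grad_coord.
  by move=> ij /=; rewrite subrr; exact: graded_cst.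
- eexists; first exact: has_grad_coord.
  by move=> ij /=; rewrite subrr; exact: graded_cst.
- have dx := @has_grad_coord R (1 + l) n (lshift l 0) i0.
  have dW := has_gradD (has_grad_cst (1 : R)) (has_gradM dx dx).
  eexists.
    apply: (eq_has_grad (has_grad_comp (h := @powR R ^~ s)
      (h' := fun t => s * t `^ (s - 1)) dW _)) => //.
    by move=> X; apply: is_derive1_powR; exact: br_gt0.
  move=> ij /=.
  rewrite (_ : 2 * s - 1 = 1 + (2 * (s - 1))); last by ring.
  apply: gradedM.
    have gx : graded sym_gen 1 (fun X => X (lshift l 0) i0).
      exact/graded_gen/sym_gen_x.
    have gc c : graded sym_gen 0 (fun=> c) by exact: graded_cst.
    apply: gradedD; first exact: graded0.
    apply: gradedD; first by rewrite -[X in graded _ X]add0r; exact: gradedM.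
    by rewrite -[X in graded _ X]addr0; exact: gradedM.
  rewrite -[X in graded _ X]add0r; apply: gradedM; first exact: graded_cst.
  exact: (graded_gen (sym_gen_bracket (s - 1))).
Qed.

Definition sym_shift (rho : R) (ij : dir) : R :=
  if fintype.split ij.1 is inr _ then rho else 0.

Section symbol_estimates.
Context (mu rho : R).
Hypotheses (mu_le0 : mu <= 0) (rho_ge0 : 0 <= rho) (rho_le1 : rho <= 1).

Let shift_le1 ij : sym_shift rho ij <= 1.
Proof. by rewrite /sym_shift; case: fintype.split. Qed.

Let shift_le ij : sym_shift rho ij <= rho.
Proof. by rewrite /sym_shift; case: fintype.split. Qed.

Let gen_grad d F : sym_gen d F ->
  exists2 F' : dir -> M -> R, has_grad F F' &
    forall ij, graded sym_gen (d - sym_shift rho ij) (F' ij).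
Proof.
move=> /sym_gen_grad[F' dF gF]; exists F' => // ij.
by apply: graded_le (gF ij) _; rewrite lerB.
Qed.

Lemma graded_sym_gauss : graded sym_gen 0 sym_gauss.
Proof.
rewrite (_ : 0 = 0 + (1 + 1) + 2 * (- 1)); last by ring.
apply: gradedM; last exact: (graded_gen (sym_gen_bracket (- 1))).
apply: gradedM; first exact: graded_cst.
apply: graded_sum => j; apply: graded_sum => i.
by apply: gradedM; exact: (graded_gen (sym_gen_xi j i)).
Qed.

Lemma graded_sym_phase : graded sym_gen (1 - rho) (sym_phase rho).
Proof.
rewrite (_ : 1 - rho = 0 + 1 + 2 * - (rho / 2)); last by field.
apply: gradedM; last exact: (graded_gen (sym_gen_bracket (- (rho / 2)))).
apply: gradedM; first exact: graded_cst.
by apply: graded_sum => j; exact: (graded_gen (sym_gen_xi j i0)).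
Qed.

Lemma sym_osc_class :
  osc_class sym_gen sym_gauss (sym_phase rho) mu (sym mu rho).
Proof.
exists (fun X => xbracket2 X `^ (mu / 2)), (fun=> 0); split => //.
- by rewrite {1}(_ : mu = 2 * (mu / 2)); [exact/graded_gen/sym_gen_bracket|field].
- exact: graded0.
Qed.

Let gauss_grad := graded_grad sym_gen_grad graded_sym_gauss.
Let phase_grad := graded_grad sym_gen_grad graded_sym_phase.

Lemma sym_smooth : smooth (sym mu rho).
Proof.
have [g' dg gg] := gauss_grad; have [p' dp gp] := phase_grad.
apply: (osc_class_smooth gen_grad dg dp _ _ sym_osc_class) => ij.
- by apply: graded_le (gg ij) _; rewrite add0r lerN2.
- by apply: graded_le (gp ij) _; rewrite addrAC subrr add0r lerN2.
Qed.

Lemma sum_sym_shift (al : 'rV[nat]_n) (be : 'M[nat]_(l, n)) :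
  \sum_(ij : dir) (col_mx al be ij.1 ij.2)%:R * sym_shift rho ij =
  rho * (mi_length be)%:R.
Proof.
rewrite -(pair_bigA _ (fun i j => (col_mx al be i j)%:R * sym_shift rho (i, j))).
rewrite big_split_ord /= [X in X + _]big1 ?add0r; last first.
  move=> i _; rewrite big1// => j _.
  by rewrite /sym_shift /= (unsplitK (inl i)) mulr0.
rewrite /mi_length natr_sum mulr_sumr; apply: eq_bigr => i _.
rewrite natr_sum mulr_sumr; apply: eq_bigr => j _.
by rewrite /sym_shift /= (unsplitK (inr i)) col_mxEd mulrC.
Qed.

(** Derivatives in x keep the order and those in xi lower it by rho. *)
Lemma sym_multi_partial_class (al : 'rV[nat]_n) (be : 'M[nat]_(l, n)) :
  osc_class sym_gen sym_gauss (sym_phase rho) (mu - rho * (mi_length be)%:R)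
    (multi_partial (col_mx al be) (sym mu rho)).
Proof.
have [g' dg gg] := gauss_grad; have [p' dp gp] := phase_grad.
rewrite -(sum_sym_shift al be).
apply: (osc_class_multi_partial gen_grad dg dp _ _ _ sym_osc_class) => ij.
- by apply: graded_le (gg ij) _; rewrite add0r lerN2.
- by apply: graded_le (gp ij) _; rewrite addrAC subrr add0r lerN2.
Qed.

Definition freq_size (X : M) : R := \sum_(j < l) enorm (row j (dsubmx X)).

Lemma freq_size_ge0 X : 0 <= freq_size X.
Proof. by rewrite sumr_ge0// => j _; exact: sqrtr_ge0. Qed.

Lemma enormE k (x : 'rV[R]_k) : enorm x = Num.sqrt (\sum_(i < k) x 0 i ^+ 2).
Proof. by rewrite /enorm /dotp; congr Num.sqrt; apply: eq_bigr. Qed.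

Let xN X := Num.sqrt (xbracket2 X).

Let xN_ge1 X : 1 <= xN X.
Proof. by rewrite -sqrtr1 ler_wsqrtr// xbracket2_ge1. Qed.

Lemma sym_gen_bound d F : sym_gen d F -> exists2 K, 0 <= K & exists k : nat,
  forall X, `|F X| <= K * xN X `^ d * (1 + freq_size X / xN X) ^+ k.
Proof.
case=> [|j i|s]; exists 1 => //.
- exists 0%N => X; rewrite mul1r mulr1 powRr1 ?sqrtr_ge0// -sqrtr_sqr.
  by rewrite ler_sqrt ?addr_ge0 ?sqr_ge0// lerDr.
- exists 1%N => X; rewrite mul1r expr1 powRr1 ?sqrtr_ge0// mulrDr mulr1.
  rewrite mulrC divfK ?gt_eqF ?(lt_le_trans _ (xN_ge1 X))//.
  rewrite -[leLHS]add0r lerD ?sqrtr_ge0// /freq_size (bigD1 j)//= -[leLHS]addr0.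
  rewrite lerD ?sumr_ge0// => [|j' _]; last exact: sqrtr_ge0.
  rewrite enormE -sqrtr_sqr ler_sqrt ?sumr_ge0// => [|i' _]; last exact: sqr_ge0.
  rewrite (bigD1 i)//= !mxE lerDl sumr_ge0// => i' _; exact: sqr_ge0.
- exists 0%N => X; rewrite mul1r mulr1 powRrM ger0_norm ?powR_ge0//.
  rewrite (_ : xN X `^ 2 = xbracket2 X)//.
  by rewrite powR_mulrn ?sqrtr_ge0// sqr_sqrtr// (le_trans _ (xbracket2_ge1 X)).
Qed.

Lemma sym_gauss_le (l_gt0 : (0 < l)%N) X :
  sym_gauss X <= - (pi / l%:R ^+ 2 * (freq_size X / xN X) ^+ 2).
Proof.
rewrite /sym_gauss powR_inv1 ?(le_trans _ (xbracket2_ge1 X))// expr_div_n.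
rewrite sqr_sqrtr ?(le_trans _ (xbracket2_ge1 X))// !mulNr lerN2.
rewrite mulrA ler_wpM2r ?invr_ge0 ?(le_trans _ (xbracket2_ge1 X))//.
rewrite -mulrA ler_wpM2l ?pi_ge0// mulrC ler_pdivrMr ?exprn_gt0 ?ltr0n//.
rewrite mulrC -[X in X%:R](card_ord l).
apply: le_trans (sqr_sum_le _) _ => [j|]; first exact: sqrtr_ge0.
rewrite ler_wpM2l ?sqr_ge0// ler_sum// => j _.
rewrite enormE sqr_sqrtr ?sumr_ge0// => [|i _]; last exact: sqr_ge0.
by apply: ler_sum => i _; rewrite !mxE.
Qed.

(** A derivative has some order d <= 0 in N.  As 1 + S <= N + S = N (1 + S / N),
    N^d is at most (1 + S)^d (1 + S / N)^(- d), and the Gaussian absorbs the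
    last factor. *)
Lemma sym_symbol_class : (0 < l)%N -> symbol_class mu rho 0 (sym mu rho).
Proof.
move=> l_gt0; split=> [|al be]; first exact: sym_smooth.
set d := mu - rho * (mi_length be)%:R.
have d0 : 0 <= - d by rewrite oppr_ge0 subr_le0 (le_trans mu_le0)// mulr_ge0.
have c0 : 0 < pi / l%:R ^+ 2 :> R by rewrite divr_gt0 ?pi_gt0 ?exprn_gt0 ?ltr0n.
pose j := (Num.truncn (- d)).+1.
have dj : - d <= j%:R by exact/ltW/truncnS_gt.
have [K K0 KP] := osc_class_bound xN_ge1 freq_size_ge0 sym_gen_bound c0
  (sym_gauss_le l_gt0) (sym_multi_partial_class al be) j.
exists K => // x xi; rewrite mul0r addr0 -/d.
set X := col_mx x xi.
have <- : freq_size X = \sum_(j < l) enorm (row j xi).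
  by rewrite /freq_size col_mxKd.
have := KP X; rewrite -/d.
have N1 := xN_ge1 X; have N0 : 0 < xN X by exact: lt_le_trans N1.
have S0 := freq_size_ge0 X.
set S := freq_size X in S0 *; set N := xN X in N1 N0 *.
have sN0 : 0 <= S / N by rewrite divr_ge0// ltW.
have [e dE] : exists e, d = - e by exists (- d); rewrite opprK.
move: d0 dj; rewrite dE opprK => d0 dj; rewrite !powRN.
have e0 : 0 < (1 + S) `^ e by rewrite powR_gt0// ltr_wpDr.
have f0 : 0 < N `^ e by rewrite powR_gt0.
rewrite !ler_pdivlMr// => h; apply: le_trans h.
rewrite mulrC mulrAC ler_wpM2r ?cabs_ge0//.
apply: (@le_trans _ _ ((1 + S / N) `^ e * N `^ e)).
  rewrite -powRM ?addr_ge0 ?(ltW N0)//; apply: ge0_ler_powR => //.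
  - by rewrite nnegrE addr_ge0.
  - by rewrite nnegrE mulr_ge0 ?addr_ge0// ltW.
  - by rewrite mulrDl mul1r divfK ?gt_eqF// lerD2r.
rewrite ler_wpM2r ?powR_ge0//.
rewrite -powR_mulrn ?addr_ge0// ler_powR// lerDl//.
Qed.

End symbol_estimates.
End symbol.

(** * Gaussians are Schwartz functions *)

Section gaussian_schwartz.
Context {R : realType} {n : nat} (kappa : R) (c : 'rV[R]_n).
Local Notation M := 'rV[R]_n.
Local Notation dir := ('I_1 * 'I_n)%type.

Definition gaussian_exponent (y : M) : R :=
  - kappa * \sum_(i < n) (y 0 i - c 0 i) ^+ 2.

Definition gaussian (y : M) : R[i] := (expR (gaussian_exponent y))%:C.

(** All generators have order 0: the decay comes from the Gaussian alone. *)
Inductive coord_gen : R -> (M -> R) -> Prop :=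
| coord_gen_sub i : coord_gen 0 (fun y => y 0 i - c 0 i).

Lemma coord_gen_grad d F : coord_gen d F ->
  exists2 F' : dir -> M -> R, has_grad F F' &
    forall ij, graded coord_gen (d - 0) (F' ij).
Proof.
case=> i; eexists.
  exact: (has_gradD (has_grad_coord 0 i) (has_grad_cst (- c 0 i))).
move=> ij /=; rewrite subr0.
by under eq_fun do rewrite addr0; exact: graded_cst.
Qed.

Lemma graded_gaussian_exponent : graded coord_gen 0 gaussian_exponent.
Proof.
rewrite -[0]addr0; apply: gradedM; first exact: graded_cst.
apply: graded_sum => i; rewrite -[0]addr0.
by apply: gradedM; exact: (graded_gen (coord_gen_sub i)).
Qed.

Lemma gaussian_osc_class :
  osc_class coord_gen gaussian_exponent (fun=> 0) 0 gaussian.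
Proof.
exists (fun=> 1), (fun=> 0); split; [exact: graded_cst|exact: graded0|].
apply/funext => y; rewrite /osc cis0 mulr1 (_ : 1 +i* 0 = 1) ?mul1r//.
Qed.

Let gauss_grad := graded_grad coord_gen_grad graded_gaussian_exponent.

Lemma gaussian_smooth : smooth gaussian.
Proof.
have [g' dg gg] := gauss_grad.
apply: (osc_class_smooth coord_gen_grad dg (has_grad_cst 0) _ _
  gaussian_osc_class) => ij.
- by rewrite -[X in graded _ X]add0r.
- exact: graded0.
Qed.

Lemma gaussian_multi_partial_class be :
  osc_class coord_gen gaussian_exponent (fun=> 0) 0 (multi_partial be gaussian).
Proof.
have [g' dg gg] := gauss_grad.
have := osc_class_multi_partial coord_gen_grad dg (has_grad_cst 0) _ _ be
  gaussian_osc_class.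
rewrite big1 ?subr0 => [|ij _]; last by rewrite mulr0.
apply => ij; [by rewrite -[X in graded _ X]add0r|exact: graded0].
Qed.

Let dist1 (y : M) : R := \sum_(i < n) `|y 0 i - c 0 i|.

Let dist1_ge0 y : 0 <= dist1 y. Proof. exact: sumr_ge0. Qed.

Let dist1_ge (y : M) i : `|y 0 i - c 0 i| <= dist1 y.
Proof. by rewrite /dist1 (bigD1 i)//= lerDl sumr_ge0. Qed.

Lemma coord_gen_bound d F : coord_gen d F ->
  exists2 K, 0 <= K & exists k : nat,
  forall y, `|F y| <= K * 1 `^ d * (1 + dist1 y / 1) ^+ k.
Proof.
case=> i; exists 1 => //; exists 1%N => y.
by rewrite powR1 !mul1r divr1 expr1 (le_trans (dist1_ge y i))// lerDr.
Qed.

Lemma schwartz_gaussian : 0 < kappa -> schwartz gaussian.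
Proof.
move=> kappa0; split=> [|al be]; first exact: gaussian_smooth.
have n0 : 0 < n%:R ^+ 2 + 1 :> R by rewrite ltr_wpDl// sqr_ge0.
have k0 : 0 < kappa / (n%:R ^+ 2 + 1) by rewrite divr_gt0.
have gle y : gaussian_exponent y <=
    - (kappa / (n%:R ^+ 2 + 1) * (dist1 y / 1) ^+ 2).
  rewrite /gaussian_exponent mulNr lerN2 divr1 -mulrA ler_wpM2l ?(ltW kappa0)//.
  rewrite ler_pdivrMl//.
  have := sqr_sum_le (fun i => normr_ge0 (y 0 i - c 0 i)).
  rewrite card_ord; under [X in _ <= _ * X -> _]eq_bigr do
    rewrite real_normK ?num_real//.
  move=> /le_trans; apply; rewrite ler_wpM2r ?lerDl//.
  by rewrite sumr_ge0// => i _; exact: sqr_ge0.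
pose j := (\sum_(i < n) al 0%R i)%N.
have [K K0 KP] := osc_class_bound (fun=> lexx 1) dist1_ge0 coord_gen_bound k0
  gle (gaussian_multi_partial_class be) j.
pose P := \prod_(i < n) (1 + `|c 0 i|) ^+ al 0 i.
have P0 : 0 <= P by rewrite prodr_ge0// => i _; rewrite exprn_ge0// addr_ge0.
exists (P * K) => y.
have := KP y; rewrite powR1 mulr1 divr1 => Ky.
apply: le_trans (ler_wpM2l P0 Ky); rewrite mulrA ler_wpM2r ?cabs_ge0//.
rewrite normr_prod /P /j -prodrXr -big_split/=.
apply: ler_prod => i _; rewrite normr_ge0/= normrX -exprMn.
rewrite lerXn2r ?nnegrE// ?mulr_ge0 ?addr_ge0//.
have := dist1_ge y i; have := ler_normD (y 0 i - c 0 i) (c 0 i).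
rewrite subrK => h1 h2; rewrite (le_trans h1)//.
have := mulr_ge0 (normr_ge0 (c 0 i)) (dist1_ge0 y).
have := normr_ge0 (c 0 i).
by lra.
Qed.

End gaussian_schwartz.

(** * The Fourier transform of a Gaussian on the line *)

Section gaussian_fourier.
Context {R : realType}.
Local Notation mu := (@lebesgue_measure R).

(** By the fundamental theorem the integral over [-n, n] is w(n) - w(-n), and it
    tends to the whole integral by dominated convergence. *)
Lemma integral_derivative_eq0 (w w' : R -> R) :
    (forall x : R, is_derive x 1 w (w' x)) -> continuous w' ->
    mu.-integrable setT (EFin \o w') ->
    w n%:R @[n --> \oo] --> (0 : R) -> w (- n%:R) @[n --> \oo] --> (0 : R) ->
  \int[mu]_x w' x = 0.
Proof.
move=> dw cw' iw' wy wNy.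
pose I n : set R := [set` `[- n.+1%:R, n.+1%:R]].
pose f n := (EFin \o w') \_ (I n).
have mw' : measurable_fun setT (EFin \o w') by case/integrableP : iw'.
have mI n : measurable (I n) by exact: measurable_itv.
have mf n : measurable_fun setT (f n).
  by apply/(measurable_restrictT _ (mI n)); exact: measurable_funTS.
have f_cvg : {ae mu, forall x, setT x -> f ^~ x @ \oo --> (EFin \o w') x}.
  apply: aeW => x _; apply: cvg_near_cst; near=> n.
  rewrite /f patchE mem_set// /I /= in_itv/= -ler_norml.
  apply: (@le_trans _ _ n%:R); last by rewrite ler_nat.
  by near: n; exact: nbhs_infty_ger.
have f_le : {ae mu, forall x n, setT x -> (`|f n x| <= (abse \o (EFin \o w')) x)%E}.
  by apply: aeW => x n _; rewrite /f patchE; case: ifP => //= _; rewrite normr0 lee_fin.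
have [_ _ fw'] :=
  @dominated_convergence _ _ R mu setT measurableT f (EFin \o w')
    (abse \o (EFin \o w')) mf mw' f_cvg (integrable_abse iw') f_le.
have fE n : (\int[mu]_x f n x)%E = (w n.+1%:R - w (- n.+1%:R))%:E.
  rewrite /f -integral_mkcond (@continuous_FTC2 _ _ w).
  - by rewrite EFinB.
  - by rewrite -subr_gt0 opprK addr_gt0.
  - exact: continuous_subspaceT.
  - have cw x : {for x, continuous w}.
      by apply/differentiable_continuous/derivable1_diffP; case: (dw x).
    split.
    + by move=> x _; case: (dw x).
    + by apply: cvg_at_right_filter; exact: cw.
    + by apply: cvg_at_left_filter; exact: cw.
  - by move=> x _; rewrite derive1E; case: (dw x).
have : ([sequence \int[mu]_x f n x]_n @ \oo --> 0)%E.
  rewrite (_ : [sequence _]_n = EFin \o (fun n => w n.+1%:R - w (- n.+1%:R))).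
    apply: cvg_EFin; first exact: nearW.
    rewrite -(subr0 0); apply: cvgB.
      by have := wy; rewrite -(cvg_shiftS (fun n => w n%:R)).
    by have := wNy; rewrite -(cvg_shiftS (fun n => w (- n%:R))).
  by apply/funext => n; rewrite /= fE.
move=> /(cvg_unique _ fw') h; rewrite /Rintegral.
by move: h => /= ->.
Unshelve. all: by end_near. Qed.

Definition gauss1 (s c x : R) : R := expR (- (pi * s * (x - c) ^+ 2)).

Lemma gauss1_ge0 s c x : 0 <= gauss1 s c x. Proof. exact: expR_ge0. Qed.

Lemma gauss1_le1 s c x : 0 <= s -> gauss1 s c x <= 1.
Proof.
by move=> s0; rewrite expR_le1 oppr_le0 mulr_ge0 ?sqr_ge0// mulr_ge0// pi_ge0.
Qed.

(** [gauss1] is a multiple of the normal density of variance 1 / (2 pi s). *)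
Lemma gauss1_pdf s c : 0 < s ->
  gauss1 s c = fun x => (Num.sqrt s)^-1 * normal_pdf c (Num.sqrt (2 * pi * s)^-1) x.
Proof.
move=> s0; have p0 : 0 < 2 * pi * s :> R by rewrite !mulr_gt0 ?pi_gt0.
apply/funext => x; rewrite normal_pdfE; last by rewrite gt_eqF// sqrtr_gt0 invr_gt0.
rewrite /normal_peak /normal_fun sqr_sqrtr ?invr_ge0 ?ltW// mulrA -invfM.
rewrite (_ : (2 * pi * s)^-1 * pi *+ 2 = s^-1); last first.
  by move: (@pi R) (pi_gt0 R) => P P0; field; rewrite !gt_eqF.
rewrite sqrtrV ?ltW// divff ?gt_eqF ?sqrtr_gt0// invr1 mul1r.
rewrite /gauss1; congr expR.
by move: (@pi R) (pi_gt0 R) => P P0; field; rewrite !gt_eqF.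
Qed.

Lemma integrable_gauss1 s c : 0 < s ->
  mu.-integrable setT (EFin \o gauss1 s c).
Proof.
move=> s0; rewrite gauss1_pdf// /comp; under eq_fun do rewrite EFinM.
by apply: integrableZl => //; exact: integrable_normal_pdf.
Qed.

Lemma Rintegral_gauss1 s c : 0 < s -> \int[mu]_x gauss1 s c x = (Num.sqrt s)^-1.
Proof.
move=> s0; rewrite gauss1_pdf// RintegralZl//; last exact: integrable_normal_pdf.
by rewrite /Rintegral integral_normal_pdf mulr1.
Qed.

Lemma is_derive_affine (a b : R) (x : R) : is_derive x 1 (fun y => a * y + b) a.
Proof.
have : is_derive x 1 (a *: (@id R) + cst b) (a *: 1 + 0) by exact: is_deriveD.
by rewrite addr0 /GRing.scale /= mulr1.
Qed.

Lemma is_derive_gauss1 s c (x : R) :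
  is_derive x 1 (gauss1 s c) (- (2 * pi * s * (x - c)) * gauss1 s c x).
Proof.
have dx : is_derive x 1 (fun y => 1 * y + - c) 1 by exact: is_derive_affine.
have dq := is_deriveZ (- (pi * s)) (is_deriveM dx dx).
have /= de := @is_derive1_comp _ _ _ _ _ _ (is_derive_expR _) dq.
rewrite (_ : gauss1 s c = expR \o (- (pi * s) *: ((fun y : R => 1 * y + - c) *
  (fun y : R => 1 * y + - c)))); last first.
  by apply/funext => y; rewrite /gauss1 /=; congr expR;
    rewrite !fctE /GRing.scale /=; ring.
apply: is_derive_eq; rewrite !fctE.
have -> : - (pi * s) *: ((1 * x - c) * (1 * x - c)) = - (pi * s * (x - c) ^+ 2).
  by rewrite /GRing.scale /=; ring.
by rewrite /GRing.scale /=; ring.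
Qed.

Lemma gauss1_cvg0 s c : 0 < s -> gauss1 s c n%:R @[n --> \oo] --> (0 : R) /\
  gauss1 s c (- n%:R) @[n --> \oo] --> (0 : R).
Proof.
move=> s0; pose a := Num.sqrt (pi * s).
have ps0 : 0 < pi * s by rewrite mulr_gt0 ?pi_gt0.
have a0 : 0 < a by rewrite sqrtr_gt0.
have cy b : gauss_fun (a * (n%:R - b)) @[n --> \oo] --> (0 : R).
  apply: (cvg_comp (fun n => a * (n%:R - b)) gauss_fun); last exact: cvg_gauss_fun.
  apply/cvgryPge => A; near=> n.
  rewrite mulrC -ler_pdivrMr// lerBrDr.
  by near: n; exact: nbhs_infty_ger.
split.
- apply: cvg_trans (cy c); apply: near_eq_cvg; apply: nearW => n.
  by rewrite /gauss_fun /gauss1 exprMn sqr_sqrtr// ltW.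
- apply: cvg_trans (cy (- c)); apply: near_eq_cvg; apply: nearW => n.
  rewrite /gauss_fun /gauss1 exprMn sqr_sqrtr ?ltW//.
  by congr expR; ring.
Unshelve. all: by end_near. Qed.

Lemma integrable_gauss1_moment s c : 0 < s ->
  mu.-integrable setT (EFin \o (fun x => `|x - c| * gauss1 s c x)).
Proof.
move=> s0; have s20 : 0 < s / 2 by rewrite divr_gt0.
have ps0 : 0 < pi * (s / 2) :> R by rewrite mulr_gt0 ?pi_gt0.
have [K K0 KP] := polynomial_gaussian_bounded 1 ps0.
apply: (@le_integrable _ _ R mu setT measurableT _
    (EFin \o (fun x => K * gauss1 (s / 2) c x))).
- apply/measurable_EFinP; apply: measurable_funM.
    by apply: measurableT_comp => //; exact: measurable_funB.
  by have /integrableP[/measurable_EFinP] := integrable_gauss1 c s0.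
- move=> x _; rewrite lee_fin !normrM normr_id (ger0_norm K0).
  rewrite !(ger0_norm (gauss1_ge0 _ _ _)) (_ : gauss1 s c x =
    gauss1 (s / 2) c x * gauss1 (s / 2) c x); last first.
    by rewrite /gauss1 -expRD; congr expR; field.
  rewrite mulrA ler_wpM2r ?gauss1_ge0//.
  apply: le_trans (KP _ (normr_ge0 (x - c))).
  by rewrite real_normK ?num_real// expr1 ler_wpM2r ?expR_ge0// lerDr.
- rewrite /comp; under eq_fun do rewrite EFinM.
  by apply: integrableZl => //; exact: integrable_gauss1.
Qed.

(* The phase theta lets the cosine stand for the real and for the imaginary
   part of an exponential, and for its modulation by the centre c. *)
Section transform.
Context (s c theta : R).
Hypothesis s_gt0 : 0 < s.

Let wave (trig : R -> R) (eta x : R) :=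
  gauss1 s c x * trig (2 * pi * (x - c) * eta + theta).

Let wave_cos_derive (x eta : R) :
  is_derive eta 1 (fun eta => wave cos eta x) (- (2 * pi * (x - c)) * wave sin eta x).
Proof.
have da := is_derive_affine (2 * pi * (x - c)) theta eta.
have dc := is_deriveZ (gauss1 s c x) (is_derive1_comp (is_derive_cos _) da).
by apply: is_derive_eq dc _; rewrite /wave /GRing.scale /=; ring.
Qed.

Let wave_sin_derive (eta x : R) : is_derive x 1 (wave sin eta)
  (s * (- (2 * pi * (x - c)) * wave sin eta x) + 2 * pi * eta * wave cos eta x).
Proof.
have da := is_derive_affine (2 * pi * eta) (theta - 2 * pi * eta * c) x.
have dc := is_deriveM (is_derive_gauss1 s c x) (is_derive1_comp (is_derive_sin _) da).
rewrite [X in is_derive _ _ X _](_ : _ = gauss1 s c *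
  (sin \o (fun y => 2 * pi * eta * y + (theta - 2 * pi * eta * c)))); last first.
  by apply/funext => y; rewrite /wave /= !fctE /=; congr (_ * sin _); ring.
apply: is_derive_eq dc _; rewrite /wave /GRing.scale /=.
rewrite (_ : 2 * pi * eta * x + (theta - 2 * pi * eta * c) =
  2 * pi * (x - c) * eta + theta); last by ring.
by ring.
Qed.

Lemma integrable_gauss1_trig (trig : R -> R) eta : measurable_fun setT trig ->
    (forall x, `|trig x| <= 1) ->
  mu.-integrable setT
    (EFin \o (fun x => gauss1 s c x * trig (2 * pi * (x - c) * eta + theta))).
Proof.
move=> mt t1.
apply: (@le_integrable _ _ R mu setT measurableT _ (EFin \o gauss1 s c)).
- apply/measurable_EFinP; apply: measurable_funM => //.
    by have /integrableP[/measurable_EFinP] := integrable_gauss1 c s_gt0.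
  apply: measurableT_comp => //.
  apply: measurable_funD => //; apply: measurable_funM => //.
  by apply: measurable_funM => //; exact: measurable_funB.
- by move=> x _; rewrite lee_fin normrM ler_piMr.
- exact: integrable_gauss1.
Qed.

Lemma integrable_gauss1_cos eta : mu.-integrable setT
  (EFin \o (fun x => gauss1 s c x * cos (2 * pi * (x - c) * eta + theta))).
Proof.
apply: integrable_gauss1_trig => [|x].
  exact: (continuous_measurable_fun (@continuous_cos R)).
by rewrite ler_norml cos_geN1 cos_le1.
Qed.

(** As a function F of eta, the integral solves F' = - (2 pi eta / s) F:
    differentiate under the integral sign, then integrate by parts ([parts]
    in the proof).  Its value at 0 is the integral of the Gaussian. *)
Lemma Rintegral_gauss1_cos eta :
  \int[mu]_x (gauss1 s c x * cos (2 * pi * (x - c) * eta + theta)) =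
  (Num.sqrt s)^-1 * expR (- (pi * eta ^+ 2 / s)) * cos theta.
Proof.
have icos e : mu.-integrable setT (EFin \o wave cos e).
  exact: integrable_gauss1_cos.
have imom : mu.-integrable setT
    (EFin \o (fun x => 2 * pi * (`|x - c| * gauss1 s c x))).
  rewrite /comp; under eq_fun do rewrite EFinM.
  by apply: integrableZl => //; exact: integrable_gauss1_moment.
have ub e x : `|- (2 * pi * (x - c)) * wave sin e x| <=
    2 * pi * (`|x - c| * gauss1 s c x).
  rewrite mulNr normrN !normrM (ger0_norm (gauss1_ge0 _ _ _)).
  rewrite [`|pi|]ger0_norm ?pi_ge0// normr_nat -mulrA ler_wpM2l ?mulr_ge0 ?pi_ge0//.
  rewrite ler_wpM2l// ler_piMr ?gauss1_ge0//.
  by rewrite ler_norml sin_geN1 sin_le1.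
have isin e : mu.-integrable setT
    (EFin \o (fun x => - (2 * pi * (x - c)) * wave sin e x)).
  have sin1 y : `|sin y| <= 1 :> R by rewrite ler_norml sin_geN1 sin_le1.
  have := integrable_gauss1_trig e (continuous_measurable_fun (@continuous_sin R)) sin1.
  move=> /integrableP[/measurable_EFinP mws _].
  apply: (@le_integrable _ _ R mu setT measurableT _ _ _ _ imom).
    apply/measurable_EFinP; apply: measurable_funM => //.
    apply: measurableT_comp => //.
    by apply: measurable_funM => //; exact: measurable_funB.
  move=> x _; rewrite lee_fin (le_trans (ub e x))//.
  exact: ler_norm.
pose F e := \int[mu]_x wave cos e x.
have parts e : \int[mu]_x (- (2 * pi * (x - c)) * wave sin e x) =
    - (2 * pi * e / s) * F e.
  have iws : mu.-integrable setT (EFin \o (fun x =>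
     s * (- (2 * pi * (x - c)) * wave sin e x))).
    rewrite /comp; under eq_fun do rewrite EFinM.
    by apply: integrableZl => //; exact: isin.
  have iwc : mu.-integrable setT (EFin \o (fun x => 2 * pi * e * wave cos e x)).
    rewrite /comp; under eq_fun do rewrite EFinM.
    by apply: integrableZl => //; exact: icos.
  have iw : mu.-integrable setT (EFin \o (fun x =>
      s * (- (2 * pi * (x - c)) * wave sin e x) + 2 * pi * e * wave cos e x)).
    rewrite /comp; under eq_fun do rewrite EFinD.
    exact: integrableD.
  have bound x : `|wave sin e x| <= gauss1 s c x.
    rewrite normrM (ger0_norm (gauss1_ge0 _ _ _)) ler_piMr ?gauss1_ge0//.
    by rewrite ler_norml sin_geN1 sin_le1.
  have [gy gNy] := gauss1_cvg0 c s_gt0.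
  have wy (t : nat -> R) : gauss1 s c (t n) @[n --> \oo] --> (0 : R) ->
      wave sin e (t n) @[n --> \oo] --> (0 : R).
    move=> gt; apply: norm_cvg0.
    apply: (@squeeze_cvgr _ _ _ _ (cst 0) (fun n => gauss1 s c (t n))) => //.
      by apply: nearW => n /=; rewrite normr_ge0 bound.
    exact: cvg_cst.
  have cont : continuous (fun x =>
      s * (- (2 * pi * (x - c)) * wave sin e x) + 2 * pi * e * wave cos e x).
    have ct (trig : R -> R) : continuous trig -> continuous (wave trig e).
      move=> ctrig x; apply: cvgM.
        apply: differentiable_continuous; apply/derivable1_diffP.
        by case: (is_derive_gauss1 s c x).
      apply: (continuous_comp (f := fun x => 2 * pi * (x - c) * e + theta));
        last exact: ctrig.
      apply: cvgD; last exact: cvg_cst.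
      apply: cvgM; last exact: cvg_cst.
      apply: cvgM; first exact: cvg_cst.
      by apply: cvgB; [exact: cvg_id|exact: cvg_cst].
    move=> x; apply: cvgD; apply: cvgM; [exact: cvg_cst| |exact: cvg_cst|].
      apply: cvgM; last exact/ct/continuous_sin.
      apply: cvgN; apply: cvgM; first exact: cvg_cst.
      by apply: cvgB; [exact: cvg_id|exact: cvg_cst].
    exact/ct/continuous_cos.
  have := integral_derivative_eq0 (wave_sin_derive e) cont iw (wy _ gy) (wy _ gNy).
  rewrite RintegralD// !RintegralZl// => h.
  have s0 : s != 0 by rewrite gt_eqF.
  apply: (mulfI s0); move/eqP : h; rewrite addr_eq0 => /eqP ->.
  by rewrite /F; field.
have dF (e : R) : is_derive e 1 F (- (2 * pi * e / s) * F e).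
  have Ie : `]e - 1, e + 1[%classic e.
    by rewrite /= in_itv/= ltrBlDr ltrDl ltr01.
  have d1E (e' x : R) : partial1of2 (fun e => wave cos e) e' x =
      - (2 * pi * (x - c)) * wave sin e' x.
    by rewrite partial1of2E; case: (wave_cos_derive x e').
  have dw (e' x : R) : derivable (fun e => wave cos e x) e' 1.
    by case: (wave_cos_derive x e').
  have G0 x : 0 <= 2 * pi * (`|x - c| * gauss1 s c x).
    by rewrite !mulr_ge0 ?pi_ge0 ?gauss1_ge0.
  have Gub (e' x : R) : `](e - 1), (e + 1)[%classic e' -> setT x ->
      `|partial1of2 (fun e => wave cos e) e' x| <= 2 * pi * (`|x - c| * gauss1 s c x).
    by move=> _ _; rewrite d1E.
  have dwI (e' x : R) : `](e - 1), (e + 1)[%classic e' -> setT x ->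
      derivable (fun e => wave cos e x) e' 1 by [].
  have icI (e' : R) : `](e - 1), (e + 1)[%classic e' ->
      mu.-integrable setT (EFin \o wave cos e') by [].
  apply: DeriveDef.
    exact: (derivable_under_integral measurableT Ie icI dwI G0 imom Gub).
  rewrite -derive1E.
  rewrite (differentiation_under_integral measurableT Ie icI dwI G0 imom Gub).
  by rewrite -parts; apply: eq_Rintegral => x _; rewrite d1E.
have dFexp (e : R) :
    is_derive e 1 (fun e => F e * expR (pi / s * (e * e))) 0.
  have did : is_derive e 1 (@id R) 1 by exact: is_derive_id.
  have dq := is_deriveZ (pi / s) (is_deriveM did did).
  have dfe := is_deriveM (dF e) (is_derive1_comp (is_derive_expR _) dq).
  apply: is_derive_eq dfe _; rewrite /GRing.scale /=.
  by field; rewrite gt_eqF.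
have FE := is_derive_0_is_cst eta 0 dFexp.
have F0 : F 0 = (Num.sqrt s)^-1 * cos theta.
  rewrite /F /wave -(Rintegral_gauss1 c s_gt0) -RintegralZr//; last exact: integrable_gauss1.
  by apply: eq_Rintegral => x _; rewrite mulr0 add0r.
move: FE; rewrite F0 mulr0 mulr0 expR0 mulr1 => FE.
set a := pi / s * (eta * eta) in FE.
have e0 : expR a != 0 by rewrite expR_eq0.
apply: (mulIf e0); rewrite [LHS]FE (_ : pi * eta ^+ 2 / s = a); last by rewrite /a; ring.
by rewrite mulrAC -[_ * _ * expR a]mulrA [expR (- a) * _]mulrC expRxMexpNx_1 mulr1.
Qed.

End transform.
End gaussian_fourier.

(** * Integrals of products of functions of one entry *)

Section complex_integral.
Context {R : realType} d (T : measurableType d) (mu : {measure set T -> \bar R}).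
Local Notation C := R[i].
Local Notation Re := (@complex.Re R).
Local Notation Im := (@complex.Im R).
Implicit Types f g : T -> C.

Definition cintegrable f := mu.-integrable setT (EFin \o (Re \o f)) /\
  mu.-integrable setT (EFin \o (Im \o f)).

Definition cint f : C :=
  (\int[mu]_x Re (f x)) +i* (\int[mu]_x Im (f x)).

Definition cmeasurable f :=
  measurable_fun setT (Re \o f) /\ measurable_fun setT (Im \o f).

Lemma cintegrable_measurable f : cintegrable f -> cmeasurable f.
Proof.
by move=> [/integrableP[/measurable_EFinP ? _] /integrableP[/measurable_EFinP ? _]].
Qed.

Lemma cmeasurableM f g : cmeasurable f -> cmeasurable g ->
  cmeasurable (fun x => f x * g x).
Proof.
move=> [mf1 mf2] [mg1 mg2]; split.
- rewrite (_ : _ \o _ = fun x => Re (f x) * Re (g x) - Im (f x) * Im (g x)).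
    by apply: measurable_funB; exact: measurable_funM.
  by apply/funext => x; exact: Re_mulc.
- rewrite (_ : _ \o _ = fun x => Re (f x) * Im (g x) + Im (f x) * Re (g x)).
    by apply: measurable_funD; exact: measurable_funM.
  by apply/funext => x; exact: Im_mulc.
Qed.

Lemma cmeasurable_cst (c : C) : cmeasurable (fun=> c).
Proof. by split; exact: measurable_cst. Qed.

Lemma cmeasurable_prod (I : Type) (r : seq I) (f : I -> T -> C) :
  (forall i, cmeasurable (f i)) -> cmeasurable (fun x => \prod_(i <- r) f i x).
Proof.
move=> mf; elim: r => [|i r IH].
  by under eq_fun do rewrite big_nil; exact: cmeasurable_cst.
by under eq_fun do rewrite big_cons; exact: cmeasurableM.
Qed.

End complex_integral.

Lemma cmeasurable_comp {R : realType} d1 d2 (T1 : measurableType d1)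
    (T2 : measurableType d2) (f : T2 -> R[i]) (g : T1 -> T2) :
  cmeasurable f -> measurable_fun setT g -> cmeasurable (f \o g).
Proof.
move=> [mf1 mf2] mg; split.
- exact: (measurableT_comp mf1 mg).
- exact: (measurableT_comp mf2 mg).
Qed.

Section product.
Context {R : realType} d1 d2 (T1 : measurableType d1) (T2 : measurableType d2).
Context (m1 : {sigma_finite_measure set T1 -> \bar R})
        (m2 : {sigma_finite_measure set T2 -> \bar R}).

Lemma integrable_prod (u : T1 -> R) (v : T2 -> R) :
  m1.-integrable setT (EFin \o u) -> m2.-integrable setT (EFin \o v) ->
  (m1 \x m2)%E.-integrable setT (EFin \o (fun p => u p.1 * v p.2)).
Proof.
move=> iu iv; have /integrableP[/measurable_EFinP mu uoo] := iu.
have /integrableP[/measurable_EFinP mv voo] := iv.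
have muv : measurable_fun setT (fun p : T1 * T2 => u p.1 * v p.2).
  by apply: measurable_funM; exact: measurableT_comp.
apply/integrable12ltyP; first exact/measurable_EFinP.
rewrite (eq_integral (fun x => `|(u x)%:E| * \int[m2]_y `|(v y)%:E|)%E).
  rewrite ge0_integralZr//; first last.
  - exact: integral_ge0.
  - by apply: measurableT_comp => //; exact/measurable_EFinP.
  by rewrite lte_mul_pinfty// ?integral_ge0// ge0_fin_numE// integral_ge0.
move=> x _; under eq_integral do rewrite /= normrM EFinM.
rewrite ge0_integralZl// ?lee_fin//.
by apply/measurable_EFinP; exact: measurableT_comp.
Qed.

Lemma Rintegral_prod (u : T1 -> R) (v : T2 -> R) :
  m1.-integrable setT (EFin \o u) -> m2.-integrable setT (EFin \o v) ->
  \int[(m1 \x m2)%E]_p (u p.1 * v p.2) = (\int[m1]_x u x) * \int[m2]_y v y.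
Proof.
move=> iu iv; have iuv := integrable_prod iu iv.
rewrite [LHS]/Rintegral -(integral12_prod_meas1 iuv) /fubini_F.
rewrite (eq_integral (fun x => (u x * \int[m2]_y v y)%:E)).
  by rewrite -RintegralZr.
move=> x _; rewrite /= EFinM fineK; last exact: integrable_fin_num.
by rewrite -integralZl//; apply: eq_integral.
Qed.

Lemma cint_prod (f : T1 -> R[i]) (g : T2 -> R[i]) :
  cintegrable m1 f -> cintegrable m2 g ->
  cintegrable (m1 \x m2)%E (fun p => f p.1 * g p.2) /\
  cint (m1 \x m2)%E (fun p => f p.1 * g p.2) = cint m1 f * cint m2 g.
Proof.
move=> [f1 f2] [g1 g2].
have i11 := integrable_prod f1 g1; have i22 := integrable_prod f2 g2.
have i12 := integrable_prod f1 g2; have i21 := integrable_prod f2 g1.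
split; first split.
- have := integrableB measurableT i11 i22; apply: eq_integrable => // p _.
  by rewrite /= -EFinB; congr EFin; rewrite [RHS]Re_mulc.
- have := integrableD measurableT i12 i21; apply: eq_integrable => // p _.
  by rewrite /= -EFinD; congr EFin; rewrite [RHS]Im_mulc.
apply/eqP; rewrite eq_complex; apply/andP; split; apply/eqP.
- rewrite [RHS]Re_mulc /= -!Rintegral_prod// -RintegralB//.
  by apply: eq_Rintegral => p _; exact: Re_mulc.
- rewrite [RHS]Im_mulc /= -!Rintegral_prod// -RintegralD//.
  by apply: eq_Rintegral => p _; exact: Im_mulc.
Qed.

End product.

Section pushforward.
Context {R : realType} d1 d2 (T1 : measurableType d1) (T2 : measurableType d2).
Context (phi : T1 -> T2) (mphi : measurable_fun setT phi).
Context (m1 : {measure set T1 -> \bar R}) (m2 : {measure set T2 -> \bar R}).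
Hypothesis m2E : forall A, measurable A -> m2 A = pushforward m1 phi A.

Let int_pushforward (F : T2 -> \bar R) : measurable_fun setT F ->
  m1.-integrable setT (F \o phi) ->
  m2.-integrable setT F /\ (\int[m2]_y F y = \int[m1]_x (F \o phi) x)%E.
Proof.
move=> mF iF; split.
  apply/integrableP; split => //; have /integrableP[_] := iF.
  rewrite (@eq_measure_integral _ _ _ _ (pushforward m1 phi)) => [|A mA _].
    rewrite (ge0_integral_pushforward mphi) ?preimage_setT//.
    exact: measurableT_comp.
  exact: m2E.
rewrite (@eq_measure_integral _ _ _ _ (pushforward m1 phi)) => [|A mA _].
  by rewrite (integral_pushforward mphi) ?preimage_setT.
exact: m2E.
Qed.

Lemma cint_pushforward (f : T2 -> R[i]) : cmeasurable f ->
  cintegrable m1 (f \o phi) -> cintegrable m2 f /\ cint m2 f = cint m1 (f \o phi).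
Proof.
move=> [mf1 mf2] [if1 if2].
have [i1 E1] := int_pushforward ((measurable_EFinP _ _).2 mf1) if1.
have [i2 E2] := int_pushforward ((measurable_EFinP _ _).2 mf2) if2.
split=> //; congr (_ +i* _); first by congr fine.
by congr fine.
Qed.

End pushforward.

Section tuples.
Context {R : realType}.
Local Notation T := (measurableTypeR R).
Local Notation C := R[i].

(** Fubini's theorem, one coordinate at a time. *)
Lemma cint_tuple n (h : 'I_n -> T -> C) :
  (forall k, cintegrable (@lebesgue_measure R) (h k)) ->
  let F (t : n.-tuple T) := \prod_(k < n) h k (tnth t k) in
  cintegrable (@lebesgue_tuple R n) F /\
  cint (@lebesgue_tuple R n) F = \prod_(k < n) cint (@lebesgue_measure R) (h k).
Proof.
elim: n h => [|n IH] h ih F.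
- have FE : F = fun=> 1 by apply/funext => t; rewrite /F big_ord0.
  have d1 : @lebesgue_tuple R 0 setT = 1%E by exact: diracT.
  have i1 (c : R) : (@lebesgue_tuple R 0).-integrable setT (EFin \o (fun=> c)).
    apply/integrableP; split; first exact: measurable_cst.
    by rewrite /comp integral_cst// [X in (_ * X)%E]d1 mule1 ltry.
  rewrite FE big_ord0; split; first by split; exact: i1.
  apply/eqP; rewrite eq_complex /cint /= !Rintegral_cst// [X in fine X]d1.
  by rewrite /= mulr1 mul0r !eqxx.
- pose h' k := h (lift ord0 k).
  have [iF' F'E] := IH h' (fun k => ih (lift ord0 k)).
  have [iG GE] := cint_prod (ih ord0) iF'.
  have FE : F \o @cons_pair R n = fun p => h ord0 p.1 *
      \prod_(k < n) h' k (tnth p.2 k).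
    apply/funext => p; rewrite /F /= big_ord_recl; congr (_ * _).
    by apply: eq_bigr => k _; rewrite /cons_pair tnthS.
  have mF : cmeasurable F.
    apply: cmeasurable_prod => k.
    apply: (cmeasurable_comp _ (measurable_tnth k)).
    exact/cintegrable_measurable/ih.
  have [] := cint_pushforward (@measurable_cons_pair R n) (m1 := (@lebesgue_measure R \x @lebesgue_tuple R n)%E) (m2 := @lebesgue_tuple R n.+1) _ mF.
  + by [].
  + by rewrite FE.
  + by move=> iF ->; split => //; rewrite FE GE F'E big_ord_recl.
Qed.

End tuples.

Section matrices.
Context {R : realType} {m n : nat}.
Local Notation M := 'M[R]_(m, n).
Local Notation C := R[i].

Lemma measurable_coord (i : 'I_m) (j : 'I_n) :
  measurable_fun setT (fun A : M => A i j : measurableTypeR R).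
Proof.
move=> _ B mB; rewrite setTI; apply: sub_sigma_algebra.
by exists (i, j) => //; exists B => //; rewrite setTI.
Qed.

Lemma cint_matrix (h : 'I_m -> 'I_n -> R -> C) :
  (forall i j, cintegrable (@lebesgue_measure R) (h i j)) ->
  let F (A : M) := \prod_(i < m) \prod_(j < n) h i j (A i j) in
  cintegrable (@lebesgue_mx R m n) F /\
  cintegral F = \prod_(i < m) \prod_(j < n) cint (@lebesgue_measure R) (h i j).
Proof.
move=> ih F; have [/= g gK Kg] := curry_mxvec_bij m n.
pose h' k := let ij := g k in h ij.1 ij.2.
have prodE (f : 'I_m -> 'I_n -> C) : \prod_(i < m) \prod_(j < n) f i j =
    \prod_(k < m * n) f (g k).1 (g k).2.
  rewrite pair_bigA /= (reindex g)//=.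
  by exists (uncurry (@mxvec_index m n)) => k _; [exact: Kg|exact: gK].
have [iT TE] := @cint_tuple R (m * n) h' (fun k => ih _ _).
have mF : cmeasurable F.
  apply: cmeasurable_prod => i; apply: cmeasurable_prod => j.
  apply: (cmeasurable_comp (f := h i j) _ (measurable_coord i j)).
  exact: (cintegrable_measurable (ih i j)).
have FE : F \o mx_of_tuple = fun t => \prod_(k < m * n) h' k (tnth t k).
  apply/funext => t; rewrite /F /= prodE; apply: eq_bigr => k _.
  by rewrite /h' mxE; congr (h _ _ (tnth t _)); rewrite -[RHS]Kg; case: (g k).
have [] := cint_pushforward (@measurable_mx_of_tuple R m n)
  (m1 := @lebesgue_tuple R (m * n)) (m2 := @lebesgue_mx R m n) _ mF.
- by [].
- by rewrite FE.
- by move=> iF FEi; split=> //; rewrite [LHS]FEi FE TE prodE.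
Qed.

End matrices.

(** * Lebesgue measure of cubes *)

Section real_products.
Context {R : realType} {m n : nat}.

Lemma real_complex_prod (I : Type) (r : seq I) (a : I -> R) :
  (\prod_(i <- r) a i)%:C = \prod_(i <- r) (a i)%:C.
Proof. exact: (rmorph_prod (@real_complex R)). Qed.

Lemma integral_matrix_prod (h : 'I_m -> 'I_n -> R -> R) :
  (forall i j, (@lebesgue_measure R).-integrable setT (EFin \o h i j)) ->
  let F (A : 'M[R]_(m, n)) := \prod_(i < m) \prod_(j < n) h i j (A i j) in
  (@lebesgue_mx R m n).-integrable setT (EFin \o F) /\
  (\int[lebesgue_mx]_A (F A)%:E =
    (\prod_(i < m) \prod_(j < n) \int[@lebesgue_measure R]_x h i j x)%:E)%E.
Proof.
move=> ih F; pose hc i j x : R[i] := (h i j x)%:C.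
have i0 : (@lebesgue_measure R).-integrable setT (EFin \o (fun=> 0)).
  exact: integrable0.
have ihc i j : cintegrable (@lebesgue_measure R) (hc i j).
  by split; [exact: ih|exact: i0].
have [[iF _]] := cint_matrix ihc.
have FcE (A : 'M[R]_(m, n)) : \prod_(i < m) \prod_(j < n) hc i j (A i j) = (F A)%:C.
  by rewrite real_complex_prod; apply: eq_bigr => i _; rewrite real_complex_prod.
have hcE i j : cint (@lebesgue_measure R) (hc i j) = (\int[@lebesgue_measure R]_x h i j x)%:C.
  by rewrite /cint /= Rintegral_cst// mul0r.
have iFr : (@lebesgue_mx R m n).-integrable setT (EFin \o F).
  by apply: eq_integrable iF => // A _; rewrite /= FcE.
have -> : \prod_i \prod_j cint (@lebesgue_measure R) (hc i j) =
    (\prod_i \prod_j \int[@lebesgue_measure R]_x h i j x)%:C.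
  rewrite real_complex_prod; apply: eq_bigr => i _.
  by rewrite real_complex_prod; apply: eq_bigr => j _.
move=> /(congr1 (@complex.Re R)) /= <-.
split=> //; rewrite /Rintegral.
under [in RHS]eq_integral do rewrite FcE.
by rewrite fineK//; exact: integrable_fin_num.
Qed.

End real_products.

Section boxes.
Context {R : realType} {m n : nat}.
Local Notation M := 'M[R]_(m, n).

Definition box (c : M) (s : R) : set M :=
  [set A | forall i j, c i j <= A i j <= c i j + s].

(** The indicator function of the box is a product of indicator functions of
    intervals. *)
Lemma lebesgue_box (c : M) (s : R) : 0 < s ->
  measurable (box c s) /\ lebesgue_mx (box c s) = (s ^+ (m * n))%:E.
Proof.
move=> s0.
pose h i j (x : R) : R := \1_([set` `[c i j, c i j + s]]) x.
have ih i j : (@lebesgue_measure R).-integrable setT (EFin \o h i j).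
  exact: integrable_indic_itv.
have hE i j : \int[@lebesgue_measure R]_x h i j x = s.
  rewrite /Rintegral [X in fine X](_ : _ = s%:E)//.
  have mJ : measurable [set` `[c i j, c i j + s]] by exact: measurable_itv.
  have -> := integral_indic (@lebesgue_measure R) measurableT mJ.
  rewrite setIT; apply: etrans (lebesgue_measure_itv _) _.
  by rewrite /= lte_fin ltrDl s0 -EFinB addrAC subrr add0r.
have [iF] := integral_matrix_prod ih.
have FE (A : M) : \prod_(i < m) \prod_(j < n) h i j (A i j) = \1_(box c s) A.
  rewrite indicE.
  case: (boolP (A \in box c s)) => [/set_mem AB|/negP nAB].
    rewrite big1// => i _; rewrite big1// => j _.
    by rewrite /h indicE mem_set//= in_itv/=; exact: AB.
  have [i [j nij]] : exists i, exists j, ~~ (c i j <= A i j <= c i j + s).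
    apply: contrapT => h0; apply: nAB; apply/mem_set => i j.
    by apply: contrapT => /negP h1; apply: h0; exists i, j.
  rewrite (bigD1 i)//= (bigD1 j)//= /h indicE memNset ?mul0r//.
  by rewrite /= in_itv/=; exact/negP.
have mB : measurable (box c s).
  have mI : measurable_fun setT (\1_(box c s) : M -> R).
    have /integrableP[/measurable_EFinP mF _] := iF.
    by apply: eq_measurable_fun mF => A _; exact: FE.
  rewrite (_ : box c s = (\1_(box c s) : M -> R) @^-1` [set 1]).
    by rewrite -[X in measurable X]setTI; apply: mI => //; exact: measurable_set1.
  apply/seteqP; split => A /=.
    by move=> AB; rewrite indicE mem_set.
  rewrite indicE; case: (boolP (A \in box c s)) => [/set_mem//|_ /eqP].
  by rewrite eq_sym oner_eq0.
under eq_integral do rewrite FE.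
rewrite integral_indic// setIT => ->; split=> //.
under eq_bigr do under eq_bigr do rewrite hE.
by rewrite !prodr_const !card_ord -exprM mulnC.
Qed.

End boxes.

(** * Gaussians in several variables *)

Section gaussian_transform.
Context {R : realType}.
Local Notation mu := (@lebesgue_measure R).

Lemma cint_gauss1 (s c eta : R) : 0 < s ->
  let h x := (gauss1 s c x)%:C * cis (2 * pi * x * eta) in
  cintegrable mu h /\
  cint mu h = ((Num.sqrt s)^-1 * expR (- (pi * eta ^+ 2 / s)))%:C *
              cis (2 * pi * c * eta).
Proof.
move=> s0 h; set th := 2 * pi * c * eta.
have hRe x : complex.Re (h x) = gauss1 s c x * cos (2 * pi * (x - c) * eta + th).
  by rewrite /h /cis /th /= mul0r subr0; congr (_ * cos _); ring.
have hIm x : complex.Im (h x) =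
    gauss1 s c x * cos (2 * pi * (x - c) * eta + (th - pi / 2)).
  rewrite addrA cosBpihalf /h /cis /th /= mul0r addr0.
  by congr (_ * sin _); ring.
have ih th' : mu.-integrable setT
    (EFin \o (fun x => gauss1 s c x * cos (2 * pi * (x - c) * eta + th'))).
  exact: integrable_gauss1_cos.
split.
  split; [apply: eq_integrable (ih th)|apply: eq_integrable (ih (th - pi / 2))] => //.
    by move=> x _; rewrite /= -hRe.
  by move=> x _; rewrite /= -hIm.
apply/eqP; rewrite eq_complex; apply/andP; split; apply/eqP.
  rewrite /cis /= mul0r subr0 -(Rintegral_gauss1_cos c th s0).
  by apply: eq_Rintegral => x _; exact: hRe.
rewrite /cis /= mul0r addr0 -cosBpihalf -(Rintegral_gauss1_cos c (th - pi / 2) s0).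
by apply: eq_Rintegral => x _; exact: hIm.
Qed.

Lemma gaussianE n (s : R) (c y : 'rV[R]_n) :
  gaussian (pi * s) c y = \prod_(i < n) (gauss1 s (c 0 i) (y 0 i))%:C.
Proof.
rewrite /gaussian -real_complex_prod /gauss1 -expR_sum; congr (expR _)%:C.
by rewrite /gaussian_exponent mulr_sumr; apply: eq_bigr => i _; rewrite mulNr.
Qed.

Lemma fourier_gaussian n (s : R) (c xi : 'rV[R]_n) : 0 < s ->
  fourier (gaussian (pi * s) c) xi = \prod_(i < n)
    (((Num.sqrt s)^-1 * expR (- (pi * xi 0 i ^+ 2 / s)))%:C *
     cis (- (2 * pi * c 0 i * xi 0 i))).
Proof.
move=> s0; pose h (i : 'I_1) j x := (gauss1 s (c 0 j) x)%:C * cis (2 * pi * x * - xi 0 j).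
have ih i j : cintegrable mu (h i j) by case: (cint_gauss1 (c 0 j) (- xi 0 j) s0).
have [_] := cint_matrix ih; rewrite [RHS]big_ord1 => hE.
rewrite /fourier; transitivity (\prod_(j < n) cint mu (h ord0 j)).
  rewrite -hE; congr cintegral; apply/funext => x.
  rewrite big_ord1 gaussianE /dotp mulr_sumr -sumrN cis_sum -big_split /=.
  by apply: eq_bigr => j _; congr (_ * cis _); ring.
apply: eq_bigr => j _; case: (cint_gauss1 (c 0 j) (- xi 0 j) s0) => _ ->.
by rewrite sqrrN mulrN.
Qed.

End gaussian_transform.

(** * The operator applied to Gaussians *)

Section polar_products.
Context {R : realType} {m n : nat}.

Lemma real_complexM (a b : R) : (a * b)%:C = a%:C * b%:C.
Proof. exact: (rmorphM (@real_complex R)). Qed.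

Lemma prod_polar (a t : 'I_m -> 'I_n -> R) :
  \prod_(i < m) \prod_(j < n) ((a i j)%:C * cis (t i j)) =
  (\prod_(i < m) \prod_(j < n) a i j)%:C *
  cis (\sum_(i < m) \sum_(j < n) t i j).
Proof.
rewrite real_complex_prod cis_sum -big_split; apply: eq_bigr => i _.
by rewrite real_complex_prod cis_sum -big_split.
Qed.

End polar_products.

Section operator.
Context {R : realType} {n l : nat} (i0 : 'I_n) (mu rho : R).
Context (s : R) (c : 'rV[R]_n).
Hypothesis s_gt0 : 0 < s.

Definition bracket2 (x : 'rV[R]_n) : R := 1 + x 0 i0 ^+ 2.

(** The displacement of x from the centre c of the input, after the translation
    by N(x)^(- rho) along the axis [i0] caused by the phase of the symbol. *)
Definition offset (x : 'rV[R]_n) (i : 'I_n) : R :=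
  x 0 i - c 0 i - (if i == i0 then bracket2 x `^ (- (rho / 2)) else 0).

(** The cutoff exp (- pi |xi|^2 / N^2) of the symbol and the transform of the
    input multiply, so their squared widths in space add up. *)
Definition width (x : 'rV[R]_n) : R := (bracket2 x)^-1 + s^-1.

Definition packet (x : 'rV[R]_n) : R := bracket2 x `^ (mu / 2) *
  \prod_(j < l) \prod_(i < n) ((Num.sqrt s)^-1 * ((Num.sqrt (width x))^-1 *
    expR (- (pi * offset x i ^+ 2 / width x)))).

Lemma bracket2_ge1 x : 1 <= bracket2 x.
Proof. by rewrite lerDl sqr_ge0. Qed.

(** The integrand is a product of functions of the single entries of xi, each of
    them a Gaussian times a character; its transform is taken at the offset. *)
Lemma psido_gaussian x :
  psido (sym i0 mu rho) (fun _ : 'I_l => gaussian (pi * s) c) x = (packet x)%:C.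
Proof.
have W1 := bracket2_ge1 x; set W := bracket2 x in W1 *.
have W0 : 0 < W by exact: lt_le_trans W1.
have S0 : 0 < width x by rewrite addr_gt0 ?invr_gt0.
pose h (j : 'I_l) i t : R[i] :=
  (gauss1 (width x) 0 t)%:C * cis (2 * pi * t * offset x i).
have ih j i : cintegrable (@lebesgue_measure R) (h j i).
  by case: (cint_gauss1 0 (offset x i) S0).
have [iF FE] := cint_matrix ih.
set F := (F in cintegral F) in FE; rewrite -/F in iF.
pose k := W `^ (mu / 2) * \prod_(j < l) \prod_(i < n) (Num.sqrt s)^-1.
have integrandE xi : sym i0 mu rho (col_mx x xi) *
    (\prod_(j < l) fourier (gaussian (pi * s) c) (row j xi)) *
    cis (2 * pi * dotp x (\sum_(j < l) row j xi)) = k%:C * F xi.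
  have xbE : xbracket2 i0 (col_mx x xi) = W by rewrite /xbracket2 col_mxEu.
  have gE : sym_gauss i0 (col_mx x xi) =
      \sum_(j < l) \sum_(i < n) - (pi * xi j i ^+ 2 / W).
    rewrite /sym_gauss xbE powR_inv1 ?ltW// -mulrA mulr_suml mulr_sumr.
    apply: eq_bigr => j _; rewrite mulr_suml mulr_sumr; apply: eq_bigr => i _.
    by rewrite col_mxEd mulrA !mulNr.
  have pE : sym_phase i0 rho (col_mx x xi) = \sum_(j < l) \sum_(i < n)
      - (2 * pi * xi j i * (if i == i0 then W `^ (- (rho / 2)) else 0)).
    rewrite /sym_phase xbE -mulrA mulr_suml mulr_sumr.
    apply: eq_bigr => j _; rewrite (bigD1 i0)//= eqxx big1 ?addr0 => [|i /negbTE ->].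
      by rewrite col_mxEd; ring.
    by rewrite mulr0 oppr0.
  have fE : \prod_(j < l) fourier (gaussian (pi * s) c) (row j xi) =
      (\prod_(j < l) \prod_(i < n)
        ((Num.sqrt s)^-1 * expR (- (pi * xi j i ^+ 2 / s))))%:C *
      cis (\sum_(j < l) \sum_(i < n) - (2 * pi * c 0 i * xi j i)).
    rewrite -prod_polar; apply: eq_bigr => j _; rewrite fourier_gaussian//.
    by apply: eq_bigr => i _; rewrite !mxE.
  have dE : 2 * pi * dotp x (\sum_(j < l) row j xi) =
      \sum_(j < l) \sum_(i < n) (2 * pi * x 0 i * xi j i).
    rewrite exchange_big /dotp mulr_sumr; apply: eq_bigr => i _ /=.
    rewrite summxE mulr_sumr mulr_sumr; apply: eq_bigr => j _.
    by rewrite !mxE mulrA.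
  rewrite /sym /osc xbE gE pE fE dE /F prod_polar.
  rewrite (_ : \sum_(j < l) \sum_(i < n) (2 * pi * xi j i * offset x i) =
    (\sum_(j < l) \sum_(i < n)
      - (2 * pi * xi j i * (if i == i0 then W `^ (- (rho / 2)) else 0))) +
    (\sum_(j < l) \sum_(i < n) - (2 * pi * c 0 i * xi j i)) +
    (\sum_(j < l) \sum_(i < n) (2 * pi * x 0 i * xi j i))); last first.
    rewrite -!big_split; apply: eq_bigr => j _; rewrite -!big_split.
    by apply: eq_bigr => i _; rewrite /offset -/W /=; ring.
  rewrite !cisD [RHS]mulrA -real_complexM.
  set E := expR _.
  have -> : k * \prod_(j < l) \prod_(i < n) gauss1 (width x) 0 (xi j i) =
    W `^ (mu / 2) * E * \prod_(j < l) \prod_(i < n)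
        ((Num.sqrt s)^-1 * expR (- (pi * xi j i ^+ 2 / s))).
    have splitE (f g : 'I_l -> 'I_n -> R) :
        \prod_(j < l) \prod_(i < n) (f j i * g j i) =
        (\prod_(j < l) \prod_(i < n) f j i) * \prod_(j < l) \prod_(i < n) g j i.
      by rewrite -big_split; apply: eq_bigr => j _; rewrite -big_split.
    rewrite splitE /k -!mulrA; congr (_ * _); rewrite [RHS]mulrCA; congr (_ * _).
    rewrite /E expR_sum -big_split; apply: eq_bigr => j _.
    rewrite expR_sum -big_split; apply: eq_bigr => i _ /=.
    rewrite -expRD /gauss1; congr expR; rewrite /width -/W.
    by move: (@pi R) => P; field; rewrite !gt_eqF.
  rewrite !real_complexM -[_ +i* 0]/(_%:C); ring.
have kF : cintegral (fun xi => k%:C * F xi) = k%:C * cintegral F.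
  case: iF => iF1 iF2; rewrite /cintegral.
  apply/eqP; rewrite eq_complex; apply/andP; split; apply/eqP.
    rewrite [RHS]Re_mulc /= mul0r subr0 -RintegralZl//.
    by apply: eq_Rintegral => A _; rewrite [LHS]Re_mulc /= mul0r subr0.
  rewrite [RHS]Im_mulc /= mul0r addr0 -RintegralZl//.
  by apply: eq_Rintegral => A _; rewrite [LHS]Im_mulc /= mul0r addr0.
rewrite /psido; under [X in cintegral X]eq_fun do rewrite integrandE.
rewrite kF FE /k /packet real_complexM -mulrA [RHS]real_complexM; congr (_ * _).
rewrite real_complex_prod [RHS]real_complex_prod -big_split; apply: eq_bigr => j _ /=.
rewrite real_complex_prod [RHS]real_complex_prod -big_split; apply: eq_bigr => i _ /=.
rewrite real_complexM; congr (_ * _).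
have [_ ->] := cint_gauss1 0 (offset x i) S0.
by rewrite mulr0 mul0r cis0 mulr1.
Qed.

End operator.

(** * Bounds for the maximal functions *)

Section sharp_maximal_lower_bound.
Context {R : realType} {n : nat}.
Local Notation V := 'rV[R]_n.

Lemma cube_box (c : V) (s : R) : 0 < s -> cube (box c s).
Proof.
move=> s0; exists c, s; split=> //; apply/seteqP; split=> y /= yB i.
  exact: yB.
by move=> j; rewrite ord1; exact: yB.
Qed.

(** Whatever constant z is subtracted from g, its real part is at distance at
    least (a - b) / 2 from g on all of A1 or on all of A2. *)
Lemma sharp_maximal_ge (t : R) (g : V -> R) (x : V) (Q A1 A2 : set V)
    (a b w v : R) :
  0 < t -> b <= a -> measurable_fun setT g ->
  cube Q -> Q x -> measurable Q -> lebesgue_mx Q = v%:E -> 0 < v ->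
  measurable A1 -> measurable A2 -> A1 `<=` Q -> A2 `<=` Q ->
  lebesgue_mx A1 = w%:E -> lebesgue_mx A2 = w%:E -> 0 <= w ->
  (forall y, A1 y -> a <= g y) -> (forall y, A2 y -> g y <= b) ->
  (((w / v) `^ t^-1 * ((a - b) / 2))%:E <= sharp_maximal t (fun y => (g y)%:C) x)%E.
Proof.
move=> t0 ba mg cQ Qx mQ Qv v0 mA1 mA2 A1Q A2Q A1w A2w w0 ga gb.
have d0 : 0 <= (a - b) / 2 by rewrite divr_ge0// subr_ge0.
apply: le_trans (ereal_sup_ubound _); last by exists Q.
apply: le_ereal_inf_tmp => _ [z _ <-].
have mF : measurable_fun setT (fun y => (cabs ((g y)%:C - z) `^ t)%:E).
  have mh : measurable_fun setT (fun y => cabs ((g y)%:C - z)).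
    have mh0 : measurable_fun setT
        (fun y => (g y - complex.Re z) ^+ 2 + complex.Im z ^+ 2).
      by apply: measurable_funD => //; apply: measurable_funX; exact: measurable_funB.
    apply: eq_measurable_fun (measurableT_comp (@measurable_powR R 2^-1) mh0) => y _.
    case: z {mh0} => z1 z2; rewrite /= powR12_sqrt ?addr_ge0 ?sqr_ge0//.
    by rewrite [RHS]cabsE add0r sqrrN.
  apply/measurable_EFinP; exact: (measurableT_comp (@measurable_powR R t) mh).
have AE A : A = A1 \/ A = A2 -> (forall y, A y -> (a - b) / 2 <= cabs ((g y)%:C - z)) ->
    ((((a - b) / 2) `^ t * w)%:E <= \int[lebesgue_mx]_(y in Q) (cabs ((g y)%:C - z) `^ t)%:E)%E.
  move=> AA gA.
  have [mA AQ Aw] : [/\ measurable A, A `<=` Q & lebesgue_mx A = w%:E].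
    by case: AA => ->.
  apply: (@le_trans _ _ (\int[lebesgue_mx]_(y in A) (cabs ((g y)%:C - z) `^ t)%:E)%E).
    rewrite EFinM -Aw -integral_cst//; apply: ge0_le_integral => //.
    - by move=> y _; rewrite lee_fin powR_ge0.
    - exact: measurable_funTS.
    - move=> y Ay; rewrite lee_fin; apply: ge0_ler_powR; rewrite ?nnegrE ?cabs_ge0 ?(ltW t0)//.
      exact: gA.
  apply: ge0_subset_integral => //; first exact: measurable_funTS.
  by move=> y _; rewrite lee_fin powR_ge0.
have intE : ((((a - b) / 2) `^ t * w)%:E <=
    \int[lebesgue_mx]_(y in Q) (cabs ((g y)%:C - z) `^ t)%:E)%E.
  have [zm|zm] := leP (complex.Re z) ((a + b) / 2).
    apply: (AE A1); first by left.
    move=> y /ga gy; apply: le_trans (normr_Re_le_cabs _).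
    by apply: le_trans (ler_norm _); rewrite raddfB /=; lra.
  apply: (AE A2); first by right.
  move=> y /gb gy; apply: le_trans (normr_Re_le_cabs _).
  by rewrite -normrN; apply: le_trans (ler_norm _); rewrite raddfB /=; lra.
rewrite [in leRHS]/vol Qv /=.
apply: (@le_trans _ _ ((v^-1 * (((a - b) / 2) `^ t * w))%:E `^ t^-1)%E).
  rewrite poweR_EFin lee_fin (_ : v^-1 * _ = (w / v) * ((a - b) / 2) `^ t); last by ring.
  rewrite [leRHS]powRM ?divr_ge0 ?powR_ge0 ?(ltW v0)// -powRrM divff ?gt_eqF// powRr1//.
apply: gt0_ler_poweR; rewrite ?invr_ge0 ?(ltW t0)// ?in_itv/= ?leey ?andbT.
- by rewrite lee_fin mulr_ge0 ?invr_ge0 ?(ltW v0)// mulr_ge0// powR_ge0.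
- rewrite mule_ge0 ?lee_fin ?invr_ge0 ?(ltW v0)//.
  by apply: integral_ge0 => y _; rewrite lee_fin powR_ge0.
- by rewrite EFinM lee_wpmul2l// lee_fin invr_ge0 ltW.
Qed.

End sharp_maximal_lower_bound.

Section multi_maximal_upper_bound.
Context {R : realType} {n l : nat} (q : R).
Hypotheses (q_gt0 : 0 < q) (l_gt0 : (0 < l)%N).
Local Notation V := 'rV[R]_n.

Lemma cabs_gaussian_powR s (c y : V) :
  cabs (((cabs (gaussian (pi * s) c y)) `^ q)%:C) =
  \prod_(i < n) gauss1 (q * s) (c 0 i) (y 0 i).
Proof.
rewrite !cabs_real ger0_norm ?powR_ge0// ger0_norm ?expR_ge0// -expRM.
rewrite /gauss1 -expR_sum /gaussian_exponent mulr_sumr mulr_suml; congr expR.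
by apply: eq_bigr => i _; ring.
Qed.

Lemma set_power_box (c : V) (s : R) : @set_power R l n
    [set y : V | forall i, c 0 i <= y 0 i <= c 0 i + s] =
  box (\matrix_(j < l, i < n) c 0 i) s.
Proof.
apply/seteqP; split=> u /= uP j.
  by move=> i; have := uP j i; rewrite !mxE.
by move=> i; have := uP j i; rewrite !mxE.
Qed.

(** Let s be the side of a cube that contains x.  If s >= v / 2, the average is at
    most s^(- n l) times the total integral, which is a multiple of
    lam^(- n l).  If s < v / 2, the cube stays at distance v / 2 from the
    centre along the axis [i0], where the Gaussian is at most
    exp (- pi q (lam v)^2 / 4). *)
Lemma multi_maximal_gaussian_le : exists2 K, 0 < K &
  forall (i0 : 'I_n) (lam v : R) (c x : V), 0 < lam -> 0 < v ->
    x 0 i0 = c 0 i0 + v ->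
  (multi_maximal_q q (fun _ : 'I_l => gaussian (pi * lam ^+ 2) c) x <=
    ((K * (lam * v) ^- (n * l)) `^ q^-1)%:E)%E.
Proof.
have pq0 : 0 < pi * q / 4 by rewrite divr_gt0// mulr_gt0// pi_gt0.
have [K2 K20 K2P] := polynomial_gaussian_bounded (n * l) pq0.
pose K1 := (2 / Num.sqrt q) ^+ (n * l).
have sq0 : 0 < Num.sqrt q by rewrite sqrtr_gt0.
have K10 : 0 < K1 by rewrite exprn_gt0// divr_gt0.
exists (K1 + K2); first by rewrite ltr_pwDl.
move=> i0 lam v c x lam0 v0 xE.
have L0 : 0 < lam * v by rewrite mulr_gt0.
have p0 : 0 < (lam * v) ^+ (n * l) by rewrite exprn_gt0.
rewrite /multi_maximal_q /multi_maximal -poweR_EFin; apply: gt0_ler_poweR.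
- by rewrite invr_ge0 ltW.
- rewrite in_itv/= leey andbT; set S := (X in ereal_sup X).
  have [z Sz z0] : exists2 z, S z & (0 <= z)%E.
    eexists.
      exists (box x 1) => //; split; first exact: cube_box.
      by move=> i j; rewrite lexx /= lerDl ler01.
    rewrite mule_ge0 ?lee_fin ?invr_ge0 ?exprn_ge0 ?fine_ge0//.
    by apply: integral_ge0 => u _; rewrite lee_fin prodr_ge0// => j _; exact: sqrtr_ge0.
  exact: le_trans z0 (ereal_sup_ubound Sz).
- by rewrite in_itv/= leey andbT lee_fin mulr_ge0 ?addr_ge0 ?invr_ge0 ?(ltW p0)// ltW.
apply: ge_ereal_sup => _ [_ [[c' [s [s0 ->]] Qx] <-]].
set Q := [set y | _].
have QE : Q = box c' s.
  by apply/seteqP; split=> y /= yB i; [move=> j; rewrite ord1|]; exact: yB.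
have volQ : vol Q = s ^+ n by rewrite /vol QE (lebesgue_box c' s0).2 mul1n.
rewrite volQ set_power_box.
have [mB BE] := lebesgue_box (\matrix_(j < l, i < n) c' 0 i) s0.
set B := box _ _ in mB BE *.
have ih (j : 'I_l) (i : 'I_n) : (@lebesgue_measure R).-integrable setT
    (EFin \o gauss1 (q * lam ^+ 2) (c 0 i)).
  by apply: integrable_gauss1; rewrite mulr_gt0// exprn_gt0.
have [iF FE] := integral_matrix_prod ih.
set F := (fun A => _) in iF FE.
have -> : (\int[lebesgue_mx]_(u in B) (\prod_(j < l)
    cabs (cabs (gaussian (pi * lam ^+ 2) c (row j u)) `^ q)%:C)%:E =
    \int[lebesgue_mx]_(u in B) (F u)%:E)%E.
  apply: eq_integral => u _; congr EFin; apply: eq_bigr => j _.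
  by rewrite cabs_gaussian_powR; apply: eq_bigr => i _; rewrite mxE.
have F0 u : 0 <= F u.
  by rewrite prodr_ge0// => j _; rewrite prodr_ge0// => i _; exact: gauss1_ge0.
have mF : measurable_fun setT (EFin \o F) by case/integrableP : iF.
have s_ge0 : 0 <= ((s ^+ n) ^+ l)^-1 by rewrite invr_ge0 !exprn_ge0 ?ltW.
have sn0 : 0 < s ^+ (n * l) by rewrite exprn_gt0.
have [vs|sv] := leP (v / 2) s.
- apply: (@le_trans _ _ (((s ^+ n) ^+ l)^-1%:E * \int[lebesgue_mx]_u (F u)%:E)%E).
    rewrite lee_wpmul2l ?lee_fin//; apply: ge0_subset_integral => //.
    by move=> u _; rewrite lee_fin.
  rewrite FE -EFinM lee_fin.
  under eq_bigr do under eq_bigr do rewrite Rintegral_gauss1 ?mulr_gt0 ?exprn_gt0//.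
  rewrite !prodr_const !card_ord sqrtrM ?(ltW q_gt0)// sqrtr_sqr gtr0_norm//.
  rewrite -!exprM mulrDl; apply: (@le_trans _ _ (K1 * (lam * v) ^- (n * l))).
    have sv : s^-1 <= 2 / v by rewrite -[2 / v]invrK invf_div lef_pV2 ?posrE ?divr_gt0.
    rewrite /K1 -!exprVn -!exprMn.
    have -> : 2 / Num.sqrt q * (lam * v)^-1 = 2 / v * (Num.sqrt q * lam)^-1.
      by field; rewrite !gt_eqF.
    have qlam0 : 0 <= (Num.sqrt q * lam)^-1 by rewrite invr_ge0 mulr_ge0 ?(ltW lam0)// ltW.
    have sV0 : 0 <= s^-1 by rewrite invr_ge0 ltW.
    have vV0 : 0 <= 2 / v by rewrite divr_ge0// ltW.
    by rewrite lerXn2r ?nnegrE ?(mulr_ge0 _ qlam0)// ler_wpM2r.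
  by rewrite lerDl mulr_ge0// invr_ge0 ltW.
- apply: (@le_trans _ _ (((s ^+ n) ^+ l)^-1%:E * \int[lebesgue_mx]_(u in B)
      (expR (- (pi * q / 4 * (lam * v) ^+ 2)))%:E)%E).
    rewrite lee_wpmul2l ?lee_fin//; apply: ge0_le_integral => //.
    + by move=> u _; rewrite lee_fin.
    + exact: measurable_funTS.
    + move=> u uB; rewrite lee_fin.
      have g1 (j : 'I_l) (i : 'I_n) : 0 <= gauss1 (q * lam ^+ 2) (c 0 i) (u j i) <= 1.
        by rewrite gauss1_ge0 gauss1_le1// mulr_ge0 ?exprn_ge0 ?ltW.
      pose j0 := Ordinal l_gt0.
      apply: (@le_trans _ _ (gauss1 (q * lam ^+ 2) (c 0 i0) (u j0 i0))).
        rewrite /F (bigD1 j0)//= (bigD1 i0)//= -mulrA ler_piMr ?gauss1_ge0//.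
        rewrite mulr_ile1 ?prodr_ile1 ?prodr_ge0//.
        - by move=> i _; case/andP: (g1 j0 i).
        - by move=> j _; rewrite prodr_ge0// => i _; case/andP: (g1 j i).
        - move=> j _; rewrite prodr_ge0 ?prodr_ile1// => i _.
          by case/andP: (g1 j i).
      rewrite ler_expR lerN2.
      have u1 : v / 2 <= u j0 i0 - c 0 i0.
        have := uB j0 i0; rewrite mxE => /andP[cu _].
        have := Qx i0; rewrite xE => /andP[_ cv].
        lra.
      rewrite (_ : pi * q / 4 * _ = pi * (q * lam ^+ 2) * (v / 2) ^+ 2); last first.
        by move: (@pi R) => P; field.
      rewrite ler_wpM2l ?mulr_ge0 ?pi_ge0 ?exprn_ge0 ?(ltW q_gt0) ?(ltW lam0)//.
      have v20 : 0 <= v / 2 by rewrite divr_ge0// ltW.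
      by rewrite lerXn2r ?nnegrE// (le_trans v20).
  rewrite integral_cst// [X in (_ * (_ * X))%E]BE -!EFinM lee_fin.
  rewrite -exprM mulrCA [(l * n)%N]mulnC mulVf ?gt_eqF// mulr1 [leRHS]mulrDl.
  apply: (@le_trans _ _ (K2 / (lam * v) ^+ (n * l))); last first.
    by rewrite lerDr mulr_ge0 ?(ltW K10)// invr_ge0 ltW.
  rewrite ler_pdivlMr// mulrC; apply: le_trans (K2P _ (ltW L0)).
  rewrite ler_wpM2r ?expR_ge0// lerXn2r ?nnegrE ?addr_ge0 ?ltW//.
  by rewrite ltrDr.
Qed.

End multi_maximal_upper_bound.

(** * Height and decay of the wave packet *)

Section packet_bounds.
Context {R : realType} {n l : nat} (i0 : 'I_n) (mu rho lam : R).
Hypotheses (mu_le0 : mu <= 0) (rho_ge0 : 0 <= rho) (rho_le1 : rho <= 1).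
Hypotheses (lam_ge1 : 1 <= lam) (l_gt0 : (0 < l)%N).
Local Notation V := 'rV[R]_n.

(** At [base_point] the bracket N takes the value [lam]. *)
Definition base_coord : R := Num.sqrt (lam ^+ 2 - 1).

Definition base_point : V := \row_i (if i == i0 then base_coord else 0).

(** The translation by lam^(- rho) takes this centre to [base_point]. *)
Definition packet_center : V :=
  \row_i (if i == i0 then base_coord - lam `^ (- rho) else 0).

Let g (x : V) := @packet R n l i0 mu rho (lam ^+ 2) packet_center x.
Let N (x : V) := Num.sqrt (bracket2 i0 x).

Let lam_gt0 : 0 < lam. Proof. exact: lt_le_trans lam_ge1. Qed.
Let lamV_ge0 : 0 <= lam^-1. Proof. by rewrite invr_ge0 ltW. Qed.

Let base_coord_ge0 : 0 <= base_coord. Proof. exact: sqrtr_ge0. Qed.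

Let base_coord2 : base_coord ^+ 2 = lam ^+ 2 - 1.
Proof. by rewrite sqr_sqrtr// subr_ge0 exprn_ege1. Qed.

Let base_coord_le : base_coord <= lam.
Proof.
rewrite -(ler_pXn2r (n := 2))// ?nnegrE ?(ltW lam_gt0)//.
by rewrite base_coord2 gerBl.
Qed.

Let bracket2_pow x a : bracket2 i0 x `^ (a / 2) = N x `^ a.
Proof.
rewrite /N -powR12_sqrt ?(le_trans _ (bracket2_ge1 i0 x))//.
by rewrite -powRrM mulrC.
Qed.

(* Near the base point the translation depends on x only through N(x), and
   [shift_ge0], [shift_le] show that it changes by at most 1 / lam. *)
Let offsetE x i : offset i0 rho packet_center x i = x 0 i - base_point 0 i +
  (if i == i0 then lam `^ (- rho) - N x `^ (- rho) else 0).
Proof.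
rewrite /offset !mxE -mulNr bracket2_pow; case: eqP => _; last by ring.
by ring.
Qed.

Section beyond.
Context (x : V).
Hypothesis x_ge : forall i, base_point 0 i <= x 0 i.

Let N_ge : lam <= N x.
Proof.
have := x_ge i0; rewrite mxE eqxx => h.
rewrite -[leLHS](ger0_norm (ltW lam_gt0)) -sqrtr_sqr ler_wsqrtr// /bracket2.
rewrite addrC -lerBlDr -base_coord2 lerXn2r ?nnegrE//.
exact: le_trans h.
Qed.

Let N_gt0 : 0 < N x. Proof. exact: lt_le_trans N_ge. Qed.

Let bracketE : bracket2 i0 x = N x ^+ 2.
Proof. by rewrite sqr_sqrtr// (le_trans _ (bracket2_ge1 i0 x)). Qed.

Let shift_ge0 : 0 <= lam `^ (- rho) - N x `^ (- rho).
Proof.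
rewrite subr_ge0 !powRN lef_pV2 ?posrE ?powR_gt0//.
by apply: ge0_ler_powR; rewrite ?nnegrE// ltW.
Qed.

Lemma offset_ge i : x 0 i - base_point 0 i <= offset i0 rho packet_center x i.
Proof. by rewrite offsetE lerDl; case: ifP. Qed.

Let width_ge : (lam ^+ 2)^-1 <= width i0 (lam ^+ 2) x.
Proof. by rewrite lerDr invr_ge0 bracketE sqr_ge0. Qed.

Let width_le : width i0 (lam ^+ 2) x <= 2 * (lam ^+ 2)^-1.
Proof.
rewrite mulr_natl mulr2n lerD2r bracketE lef_pV2 ?posrE ?exprn_gt0//.
by rewrite lerXn2r ?nnegrE ?(ltW lam_gt0) ?(ltW N_gt0).
Qed.

Let width_gt0 : 0 < width i0 (lam ^+ 2) x.
Proof. by apply: lt_le_trans width_ge; rewrite invr_gt0 exprn_gt0. Qed.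

Let amplitude : (Num.sqrt (lam ^+ 2))^-1 * (Num.sqrt (width i0 (lam ^+ 2) x))^-1 =
  (Num.sqrt (lam ^+ 2 * width i0 (lam ^+ 2) x))^-1.
Proof. by rewrite -invfM -sqrtrM// exprn_ge0// ltW. Qed.

Let l2w_ge : 1 <= lam ^+ 2 * width i0 (lam ^+ 2) x.
Proof. by rewrite -ler_pdivrMl ?exprn_gt0// mulr1. Qed.

Let l2w_le : lam ^+ 2 * width i0 (lam ^+ 2) x <= 2.
Proof. by rewrite -ler_pdivlMl ?exprn_gt0// mulrC. Qed.

(** Each of the n l factors is at most exp (- pi B^2 / 2), since the squared width
    is at most 2 / lam^2; one of them gives the bound. *)
Lemma packet_le B : 0 <= B -> (forall i, base_point 0 i + B / lam <= x 0 i) ->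
  g x <= expR (- (pi * B ^+ 2 / 2)) * lam `^ mu.
Proof.
move=> B0 xB; rewrite /g /packet bracket2_pow mulrC.
have e1 : expR (- (pi * B ^+ 2 / 2)) <= 1 :> R.
  by rewrite expR_le1 oppr_le0 divr_ge0// mulr_ge0 ?pi_ge0 ?sqr_ge0.
rewrite ler_pM ?powR_ge0//.
- by rewrite prodr_ge0// => j _; rewrite prodr_ge0// => i _;
    rewrite !mulr_ge0 ?expR_ge0 ?invr_ge0 ?sqrtr_ge0.
- apply: (@le_trans _ _ (\prod_(j < l) \prod_(i < n) expR (- (pi * B ^+ 2 / 2)))).
    apply: ler_prod => j _; apply/andP; split.
      by rewrite prodr_ge0// => i _; rewrite !mulr_ge0 ?expR_ge0 ?invr_ge0 ?sqrtr_ge0.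
    apply: ler_prod => i _; apply/andP; split.
      by rewrite !mulr_ge0 ?expR_ge0 ?invr_ge0 ?sqrtr_ge0.
    rewrite mulrA amplitude -[leRHS]mul1r ler_pM ?expR_ge0 ?invr_ge0 ?sqrtr_ge0//.
      by rewrite invf_le1 ?sqrtr_gt0 ?mulr_gt0 ?exprn_gt0// -sqrtr1 ler_wsqrtr.
    rewrite ler_expR lerN2 ler_pdivlMr// -2!mulrA ler_wpM2l ?pi_ge0//.
    have zB : B / lam <= offset i0 rho packet_center x i.
      by apply: le_trans (offset_ge i); rewrite lerBrDl.
    have Bl0 : 0 <= B / lam by rewrite divr_ge0// ltW.
    apply: (@le_trans _ _ ((B / lam) ^+ 2)); last first.
      by rewrite lerXn2r ?nnegrE// (le_trans Bl0).
    rewrite expr_div_n -mulrA ler_wpM2l ?sqr_ge0// ler_pdivrMl//.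
  rewrite !prodr_const !card_ord -exprM.
  have : (0 < n * l)%N by rewrite muln_gt0 l_gt0 (leq_ltn_trans _ (ltn_ord i0)).
  case: (n * l)%N => // k _; rewrite exprS ler_piMr ?expR_ge0//.
  by rewrite exprn_ile1 ?expR_ge0.
- rewrite -(opprK mu) [leLHS]powRN [leRHS]powRN lef_pV2 ?posrE ?powR_gt0//.
  by apply: ge0_ler_powR; rewrite ?nnegrE ?oppr_ge0// ltW.
Qed.

Hypothesis x_le : forall i, x 0 i <= base_point 0 i + lam^-1.

Let N_le : N x <= lam + lam^-1.
Proof.
have := x_le i0; have := x_ge i0; rewrite mxE eqxx => h1 h2.
have p0 : 0 <= lam + lam^-1 by rewrite addr_ge0// ltW.
rewrite -[leRHS](ger0_norm p0) -sqrtr_sqr ler_wsqrtr// /bracket2.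
apply: (@le_trans _ _ (1 + (base_coord + lam^-1) ^+ 2)).
  by rewrite lerD2l lerXn2r ?nnegrE ?addr_ge0 ?(le_trans _ h1).
have -> : (lam + lam^-1) ^+ 2 = lam ^+ 2 + 2 + lam^-1 ^+ 2.
  by field; rewrite gt_eqF.
rewrite sqrrD base_coord2.
have : base_coord * lam^-1 <= 1 by rewrite ler_pdivrMr// mul1r.
by rewrite -mulr_natl; lra.
Qed.

(* (N / lam)^rho <= N / lam because rho <= 1, and N - lam <= 1 / lam. *)
Let shift_le : lam `^ (- rho) - N x `^ (- rho) <= lam^-1.
Proof.
have Nl1 : 1 <= N x / lam by rewrite ler_pdivlMr// mul1r.
have NE : N x `^ (- rho) = lam `^ (- rho) * (N x / lam) `^ (- rho).
  rewrite -powRM ?(ltW lam_gt0)// ?(le_trans _ Nl1)//.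
  by rewrite mulrC divfK ?gt_eqF.
have lr1 : lam `^ (- rho) <= 1.
  by rewrite -[leRHS](powRr0 lam) ler_powR// oppr_le0.
have Nr : lam / N x <= (N x / lam) `^ (- rho).
  rewrite powRN -[lam / N x]invf_div lef_pV2 ?posrE ?powR_gt0 ?divr_gt0//.
  exact: ler1_powR.
have Nr1 : lam / N x <= 1 by rewrite ler_pdivrMr// mul1r.
have h : 1 - lam / N x <= lam^-1.
  have -> : 1 - lam / N x = (N x - lam) / N x by rewrite mulrBl divff ?gt_eqF.
  rewrite ler_pdivrMr//.
  apply: (@le_trans _ _ lam^-1); first by rewrite lerBlDl.
  by rewrite ler_peMr// (le_trans lam_ge1).
rewrite NE -[X in X - _]mulr1 -mulrBr.
apply: (@le_trans _ _ (lam `^ (- rho) * (1 - lam / N x))).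
  by rewrite ler_wpM2l ?powR_ge0// lerB.
by apply: le_trans h; rewrite ler_piMl// subr_ge0.
Qed.

(** On this cube N <= 2 lam and the offsets are at most 2 / lam, while the squared
    width lies between 1 / lam^2 and 2 / lam^2. *)
Lemma packet_ge : 2 `^ mu * ((Num.sqrt 2)^-1 * expR (- (4 * pi))) ^+ (n * l) * lam `^ mu
  <= g x.
Proof.
rewrite /g /packet bracket2_pow mulrAC -powRM// ?(ltW lam_gt0)//.
have f0 : 0 <= (Num.sqrt 2)^-1 * expR (- (4 * pi)) :> R.
  by rewrite mulr_ge0 ?expR_ge0// invr_ge0 sqrtr_ge0.
rewrite ler_pM ?powR_ge0 ?exprn_ge0//.
  rewrite -(opprK mu) [leLHS]powRN [leRHS]powRN lef_pV2 ?posrE ?powR_gt0 ?mulr_gt0//.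
  apply: ge0_ler_powR; rewrite ?nnegrE ?oppr_ge0 ?(ltW N_gt0) ?mulr_ge0 ?(ltW lam_gt0)//.
  apply: le_trans N_le _; rewrite mulr_natl mulr2n lerD2l.
  by rewrite (le_trans _ lam_ge1)// invf_le1.
apply: (@le_trans _ _ (\prod_(j < l) \prod_(i < n)
    ((Num.sqrt 2)^-1 * expR (- (4 * pi))))).
  by rewrite !prodr_const !card_ord -exprM.
apply: ler_prod => j _; rewrite prodr_ge0//=; apply: ler_prod => i _; rewrite f0/=.
rewrite mulrA amplitude ler_pM ?expR_ge0 ?invr_ge0 ?sqrtr_ge0//.
  rewrite lef_pV2 ?posrE ?sqrtr_gt0 ?mulr_gt0 ?exprn_gt0//.
  by rewrite ler_wsqrtr.
rewrite ler_expR lerN2 ler_pdivrMr// [4 * pi]mulrC -mulrA ler_wpM2l ?pi_ge0//.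
have z0 : 0 <= offset i0 rho packet_center x i.
  by apply: le_trans (offset_ge i); rewrite subr_ge0.
have z2 : offset i0 rho packet_center x i <= 2 * lam^-1.
  rewrite offsetE mulr_natl mulr2n lerD//; first by rewrite lerBlDl.
  by case: ifP.
apply: (@le_trans _ _ ((2 * lam^-1) ^+ 2)).
  by rewrite lerXn2r ?nnegrE ?mulr_ge0.
rewrite exprMn exprVn (_ : 2 ^+ 2 = 4); last by ring.
by rewrite ler_wpM2l.
Qed.

End beyond.

Lemma measurable_packet : measurable_fun setT g.
Proof.
have mx i : measurable_fun setT (fun x : V => x 0 i) by exact: measurable_coord.
have mW : measurable_fun setT (bracket2 i0 : V -> R).
  by apply: measurable_funD => //; exact: measurable_funX.
have mpow (h : V -> R) a : measurable_fun setT h -> measurable_fun setT (fun x => h x `^ a).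
  by move=> mh; exact: (measurableT_comp (@measurable_powR R a) mh).
have W0 x : 0 <= bracket2 i0 x by rewrite (le_trans _ (bracket2_ge1 i0 x)).
have mw : measurable_fun setT (width i0 (lam ^+ 2) : V -> R).
  apply: measurable_funD => //.
  by apply: eq_measurable_fun (mpow _ (- 1) mW) => x _; rewrite powR_inv1.
have w0 x : 0 <= width i0 (lam ^+ 2) x.
  by rewrite addr_ge0 ?invr_ge0 ?W0 ?sqr_ge0.
have mo i : measurable_fun setT (fun x => offset i0 rho packet_center x i).
  apply: measurable_funB; first exact: measurable_funB.
  by case: (i == i0); [exact: mpow|].
apply: measurable_funM; first exact: mpow.
apply: measurable_prod => // j _; apply: measurable_prod => // i _.
apply: measurable_funM => //; apply: measurable_funM.
  apply: eq_measurable_fun (mpow _ (- 2^-1) mw) => x _.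
  by rewrite powRN powR12_sqrt.
apply: measurableT_comp => //; apply: measurableT_comp => //.
apply: eq_measurable_fun (measurable_funM (measurable_funM (measurable_cst pi)
  (measurable_funX 2 (mo i))) (mpow _ (- 1) mw)) => x _.
by rewrite /= powR_inv1.
Qed.

End packet_bounds.

(** * Comparison of the two bounds *)

Section growth_comparison.
Context {R : realType}.

Lemma powR_unbounded (kappa C e : R) : 0 < kappa -> 0 < e ->
  ~ (forall lam, 1 <= lam -> kappa * lam `^ e <= C).
Proof.
move=> k0 e0 H.
have C0 : 0 <= C by apply: le_trans (H 1 (lexx _)); rewrite mulr_ge0 ?powR_ge0// ltW.
have b1 : 1 <= C / kappa + 1 by rewrite lerDr divr_ge0// ltW.
have := H ((C / kappa + 1) `^ e^-1).
rewrite -powRrM mulVf ?gt_eqF// powRr1 ?(le_trans _ b1)// mulrDr mulr1.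
rewrite mulrCA divff ?gt_eqF// mulr1 => h.
have : C + kappa <= C.
  by apply: h; rewrite -[leLHS](powRr0 (C / kappa + 1)) ler_powR// invr_ge0 ltW.
by rewrite gerDl leNgt k0.
Qed.

End growth_comparison.

Theorem corollary3 (R : realType) (n l : nat) (rho r q : R)
  (n_gt0 : (0 < n)%N) (l_gt0 : (0 < l)%N)
  (rho_ge0 : 0 <= rho) (rho_lt1 : rho < 1)
  (r_gt1 : 1 < r) (r_le2 : r <= 2) (q_gt0 : 0 < q)
  (sharp_bound : forall a : 'M[R]_(1 + l, n) -> R[i],
    symbol_class (- (n%:R * l%:R / r) * (1 - rho)) rho 0 a ->
    exists2 C_a : R, 0 < C_a &
      forall f : 'I_l -> 'rV[R]_n -> R[i],
        (forall j, schwartz (f j)) ->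
        forall x : 'rV[R]_n,
          (sharp_maximal (r / l%:R) (psido a f) x <=
             C_a%:E * multi_maximal_q q f x)%E) :
  r <= q.
Proof.
rewrite leNgt; apply/negP => qr.
pose i0 := Ordinal n_gt0; set mu := - (n%:R * l%:R / r) * (1 - rho).
have r0 : 0 < r by exact: lt_trans r_gt1.
have nl0 : 0 < n%:R * l%:R :> R by rewrite mulr_gt0 ?ltr0n.
have rho1 : 0 < 1 - rho by rewrite subr_gt0.
have mu_le0 : mu <= 0.
  by rewrite /mu mulNr oppr_le0 mulr_ge0 ?(ltW rho1)// divr_ge0// ltW.
have [C C0 CP] := sharp_bound _ (sym_symbol_class i0 mu_le0 rho_ge0 (ltW rho_lt1) l_gt0).
have [K K0 KP] := @multi_maximal_gaussian_le R n l q q_gt0 l_gt0.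
pose al : R := 2 `^ mu * ((Num.sqrt 2)^-1 * expR (- (4 * pi))) ^+ (n * l).
have al0 : 0 < al.
  by rewrite mulr_gt0 ?powR_gt0// exprn_gt0// mulr_gt0 ?expR_gt0// invr_gt0 sqrtr_gt0.
(* B is chosen with pi B^2 / 2 = 2 / al, and exp y >= y for y = 2 / al. *)
pose B := Num.sqrt (4 / al / pi).
have B0 : 0 <= B by exact: sqrtr_ge0.
have Bal : expR (- (pi * B ^+ 2 / 2)) <= al / 2.
  rewrite sqr_sqrtr ?divr_ge0 ?pi_ge0 ?(ltW al0)//.
  rewrite (_ : pi * _ / 2 = 2 / al); last first.
    by move: (@pi R) (pi_gt0 R) => P P0; field; rewrite !gt_eqF.
  rewrite expRN -[leRHS]invrK invf_div lef_pV2 ?posrE ?expR_gt0 ?divr_gt0//.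
  by rewrite (le_trans _ (expR_ge1Dx _))// lerDr.
pose t : R := r / l%:R.
have t0 : 0 < t by rewrite divr_gt0// ltr0n.
pose kappa : R := (((B + 1) ^+ n)^-1) `^ t^-1 * (al / 4).
have B1 : 0 < B + 1 by rewrite ltr_wpDl.
have kappa0 : 0 < kappa.
  by rewrite mulr_gt0 ?divr_gt0// powR_gt0// invr_gt0 exprn_gt0.
pose e : R := n%:R * l%:R * (q^-1 - r^-1) * (1 - rho).
have e0 : 0 < e.
  by rewrite mulr_gt0// mulr_gt0// subr_gt0 ltf_pV2 ?posrE.
apply: (@powR_unbounded R kappa (C * K `^ q^-1) e) => // lam lam1.
have lam0 : 0 < lam by exact: lt_le_trans lam1.
pose x0 : 'rV[R]_n := base_point i0 lam.
pose c : 'rV[R]_n := packet_center i0 rho lam.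
pose f (j : 'I_l) := gaussian (pi * lam ^+ 2) c.
have sf j : schwartz (f j).
  by apply: schwartz_gaussian; rewrite mulr_gt0 ?pi_gt0// exprn_gt0.
have sharp_le := CP f sf x0.
(* The Gaussian is centred at distance v = lam^(- rho) from x0. *)
have max_le : (multi_maximal_q q f x0 <=
    ((K * (lam * lam `^ (- rho)) ^- (n * l)) `^ q^-1)%:E)%E.
  apply: (KP i0) => //; first exact: powR_gt0.
  by rewrite !mxE eqxx subrK.
have sharp_ge : ((kappa * lam `^ mu)%:E <=
    sharp_maximal t (psido (sym i0 mu rho) f) x0)%E.
  have psE : psido (sym i0 mu rho) f =
      fun x => (@packet R n l i0 mu rho (lam ^+ 2) c x)%:C.
    by apply/funext => x; apply: psido_gaussian; rewrite exprn_gt0.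
  have B1lam : 0 < (B + 1) / lam by rewrite divr_gt0.
  have lamV : 0 < lam^-1 by rewrite invr_gt0.
  (* The packet is at least al lam^mu on the cube of side 1 / lam with corner x0
     and at most half of that on its translate with corner x1. *)
  pose x1 : 'rV[R]_n := \row_i (x0 0 i + B / lam).
  have [mQ Qv] := lebesgue_box x0 B1lam; rewrite mul1n in Qv.
  have [mA1 A1w] := lebesgue_box x0 lamV; rewrite mul1n in A1w.
  have [mA2 A2w] := lebesgue_box x1 lamV; rewrite mul1n in A2w.
  have lam_mu : 0 < lam `^ mu by exact: powR_gt0.
  have ba : al / 2 * lam `^ mu <= al * lam `^ mu by rewrite ler_wpM2r ?(ltW lam_mu)//; lra.
  have Bl0 : 0 <= B / lam by rewrite divr_ge0// ltW.
  have Bl1 : (B + 1) / lam = B / lam + lam^-1 by rewrite mulrDl mul1r.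
  rewrite psE.
  have Qx : box x0 ((B + 1) / lam) x0.
    by move=> i j; rewrite lexx /= lerDl ltW.
  have A1Q : box x0 lam^-1 `<=` box x0 ((B + 1) / lam).
    move=> y yA i j; have /andP[-> /= h] := yA i j.
    by rewrite (le_trans h)// lerD2l Bl1 lerDr.
  have A2Q : box x1 lam^-1 `<=` box x0 ((B + 1) / lam).
    move=> y yA i j; have := yA i j; rewrite mxE !ord1 => /andP[h1 h2].
    by rewrite (le_trans _ h1) ?lerDl//= (le_trans h2)// -addrA lerD2l Bl1.
  have ga y : box x0 lam^-1 y -> al * lam `^ mu <= @packet R n l i0 mu rho (lam ^+ 2) c y.
    move=> yA; apply: (packet_ge mu_le0 rho_ge0 (ltW rho_lt1) lam1) => i.
      by case/andP : (yA 0 i).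
    by case/andP : (yA 0 i).
  have gb y : box x1 lam^-1 y ->
      @packet R n l i0 mu rho (lam ^+ 2) c y <= al / 2 * lam `^ mu.
    move=> yA.
    have yB i : x0 0 i + B / lam <= y 0 i.
      by have := yA 0 i; rewrite mxE => /andP[].
    have y0 i : x0 0 i <= y 0 i by rewrite (le_trans _ (yB i))// lerDl.
    apply: le_trans (packet_le mu_le0 rho_ge0 lam1 l_gt0 y0 B0 yB) _.
    by rewrite ler_wpM2r// ltW.
  have mg : measurable_fun setT (@packet R n l i0 mu rho (lam ^+ 2) c).
    exact: measurable_packet.
  have := sharp_maximal_ge t0 ba mg (cube_box x0 B1lam) Qx mQ Qv
    (exprn_gt0 n B1lam) mA1 mA2 A1Q A2Q A1w A2w (exprn_ge0 n (ltW lamV)) ga gb.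
  apply: le_trans; rewrite lee_fin.
  rewrite (_ : lam^-1 ^+ n / ((B + 1) / lam) ^+ n = ((B + 1) ^+ n)^-1); last first.
    by rewrite -!exprVn -exprMn; congr (_ ^+ n); field; rewrite !gt_eqF.
  by rewrite /kappa -mulrA ler_wpM2l ?powR_ge0//; lra.
have : kappa * lam `^ mu <= C * (K * (lam * lam `^ (- rho)) ^- (n * l)) `^ q^-1.
  rewrite -lee_fin (le_trans sharp_ge)// (le_trans sharp_le)// EFinM.
  by rewrite lee_pmul2l.
have LE : lam * lam `^ (- rho) = lam `^ (1 - rho).
  by rewrite powRD ?gt_eqF ?implybT// powRr1// ltW.
rewrite LE; set L := lam `^ (1 - rho).
have L0 : 0 < L by exact: powR_gt0.
have muE : lam `^ mu = L `^ (- (n%:R * l%:R / r)).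
  by rewrite /L -powRrM /mu; congr (_ `^ _); ring.
have eE : lam `^ e = L `^ (n%:R * l%:R * (q^-1 - r^-1)).
  by rewrite /L -powRrM /e mulrC.
rewrite muE eE -powR_invn ?(ltW L0)// powRM ?powR_ge0 ?(ltW K0)// -powRrM => h.
have Lq0 : 0 < L `^ (n%:R * l%:R / q) by exact: powR_gt0.
rewrite mulrBr powRD; last by rewrite (gt_eqF L0) implybT.
rewrite [_ * L `^ (- _)]mulrC mulrA.
rewrite -ler_pdivlMr// -powRN.
by move: h; rewrite natrM mulrA mulNr.
Qed.
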